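(* Let $K$ be a field of characteristic $0$. The multiplicities $m(\lambda,\mu)$ in the cocharacter sequence $$\chi_{p,q}(\mathfrak B_{\rm sup})=\sum_{\lambda\vdash p,\ \mu\vdash q}m(\lambda,\mu)\,\chi_\lambda\otimes\chi_\mu,\qquad p,q\ge0,\ p+q>0,$$ of the variety $\mathfrak B_{\rm sup}$ of bicommutative superalgebras over $K$ are $$m(\lambda,\mu)=\begin{cases}(\lambda_1-\lambda_2+1)(\mu_1'-\mu_2'+1),&\text{if }\lambda=(\lambda_1,\lambda_2),\ \mu'=(\mu_1',\mu_2'),\ \lambda_2+\mu_2'>0,\\(\lambda_1+1)(\mu_1'+1)-2,&\text{if }|\lambda|+|\mu|\ge2,\ \lambda_2=\mu_2'=0,\\1,&\text{if }|\lambda|+|\mu|=1,\\0&\text{otherwise.}\end{cases}$$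
   Context: Algebras are not assumed associative or unital. A superalgebra is an algebra $A=A_0\oplus A_1$ with $A_iA_j\subseteq A_{i+j\,(\mathrm{mod}\,2)}$; for $a\in A_i$ write $\overline a=i$. A superalgebra is bicommutative if for all homogeneous elements $x_1(x_2x_3)=(-1)^{\overline{x_1}\,\overline{x_2}}x_2(x_1x_3)$ and $(x_1x_2)x_3=(-1)^{\overline{x_2}\,\overline{x_3}}(x_1x_3)x_2$. $F(\mathfrak B_{\rm sup})$ is the free bicommutative superalgebra on even generators $y_1,y_2,\dots$ and odd generators $z_1,z_2,\dots$. $P_{p,q}(\mathfrak B_{\rm sup})$ is the multilinear component of $F(\mathfrak B_{\rm sup})$ in $y_1,\dots,y_p,z_1,\dots,z_q$; the group $S_p\times S_q$ acts on it by permuting the $y$'s and the $z$'s, and $\chi_{p,q}(\mathfrak B_{\rm sup})$ is its character. $\chi_\lambda$ is the irreducible character of the symmetric group indexed by the partition $\lambda$. $\mu'$ denotes the conjugate partition of $\mu$, with parts $\mu_1'\ge\mu_2'\ge\cdots$. The notation $\lambda=(\lambda_1,\lambda_2)$ (resp. $\mu'=(\mu_1',\mu_2')$) means that the partition has at most two nonzero parts (parts may be $0$), and $|\lambda|$ is the sum of the parts. *)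

(* Defs.v *)
From HB Require Import structures.
From mathcomp Require Import all_boot all_order all_algebra all_fingroup all_character.
From mathcomp Require Import generic_quotient ring_quotient finmap.
From mathcomp Require Import monalg.
From mathcomp Require Import boolp.

Set Implicit Arguments.
Unset Strict Implicit.
Unset Printing Implicit Defensive.

Import GRing.Theory.
Local Open Scope ring_scope.
Local Open Scope quotient_scope.

(* [inl i] is the even generator y_(i+1), [inr j] the odd generator z_(j+1). *)
Notation gen := (nat + nat)%type.

Inductive monomial := Gen of gen | Mul of monomial & monomial.

Fixpoint tree_of_monomial t : GenTree.tree gen :=
  match t with
  | Gen x => GenTree.Leaf x
  | Mul u v => GenTree.Node 0 [:: tree_of_monomial u; tree_of_monomial v]
  end.

Fixpoint monomial_of_tree t : option monomial :=
  match t with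
  | GenTree.Leaf x => Some (Gen x)
  | GenTree.Node _ [:: u; v] =>
    if (monomial_of_tree u, monomial_of_tree v) is (Some u', Some v')
    then Some (Mul u' v') else None
  | _ => None
  end.

Lemma tree_of_monomialK : pcancel tree_of_monomial monomial_of_tree.
Proof. by elim=> //= u -> v ->. Qed.

HB.instance Definition _ := Countable.copy monomial (pcan_type tree_of_monomialK).

Fixpoint leaves t : seq gen :=
  match t with Gen x => [:: x] | Mul u v => leaves u ++ leaves v end.

Fixpoint parity t : bool :=
  match t with
  | Gen (inl _) => false
  | Gen (inr _) => true
  | Mul u v => parity u (+) parity v
  end.

Definition map_gen (hy hz : nat -> nat) (x : gen) : gen :=
  match x with inl i => inl (hy i) | inr j => inr (hz j) end.

Fixpoint map_monomial (hy hz : nat -> nat) t : monomial :=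
  match t with
  | Gen x => Gen (map_gen hy hz x)
  | Mul u v => Mul (map_monomial hy hz u) (map_monomial hy hz v)
  end.

Lemma parity_map_monomial hy hz t : parity (map_monomial hy hz t) = parity t.
Proof. by elim: t => [[]|u IHu v IHv] //=; rewrite IHu IHv. Qed.

Section LinearExtension.
Variable K : fieldType.

(* The free nonassociative algebra on the generators. *)
Notation A := {malg K[monomial]}.

(* The linear extension of a map defined on monomials. *)
Definition linext (V : lmodType K) (phi : monomial -> V) (f : A) : V :=
  \sum_(u <- msupp f) f@_u *: phi u.

Lemma linextEw (V : lmodType K) (phi : monomial -> V) (d : {fset monomial}) f :
  fsubset (msupp f) d -> linext phi f = \sum_(u <- d) f@_u *: phi u.
Proof.
move=> sfd; apply/esym; rewrite /linext (big_fset_incl _ sfd) // => u _ /mcoeff_outdom ->.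
by rewrite scale0r.
Qed.

Lemma linext_is_linear (V : lmodType K) (phi : monomial -> V) :
  linear (linext phi).
Proof.
move=> c f g; set d := (msupp f `|` msupp g `|` msupp (c *: f + g))%fset.
rewrite !(@linextEw _ _ d) ?fsubsetUr //;
  try by rewrite /d -?fsetUA ?fsubsetUl // fsetUCA fsubsetUl.
rewrite scaler_sumr -big_split; apply: eq_bigr => u _ /=.
by rewrite mcoeffD mcoeffZ scalerDl scalerA.
Qed.

HB.instance Definition _ (V : lmodType K) (phi : monomial -> V) :=
  GRing.isLinear.Build K A V _ (linext phi) (linext_is_linear phi).

Lemma linextU (V : lmodType K) (phi : monomial -> V) u : linext phi << u >> = phi u.
Proof. by rewrite /linext msuppU oner_eq0 big_seq_fset1 mcoeffUU scale1r. Qed.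

Lemma linear_linext (V W : lmodType K) (h : {linear V -> W}) (phi : monomial -> V) f :
  h (linext phi f) = linext (fun u => h (phi u)) f.
Proof. by rewrite linear_sum; apply: eq_bigr => u _; rewrite linearZ. Qed.

Lemma eq_linext (V : lmodType K) (phi psi : monomial -> V) :
  phi =1 psi -> linext phi =1 linext psi.
Proof. by move=> eq_phi f; apply: eq_bigr => u _; rewrite eq_phi. Qed.

End LinearExtension.

HB.lock Definition amul (K : fieldType) (f g : {malg K[monomial]}) : {malg K[monomial]} :=
  linext (fun u => linext (fun v => << Mul u v >>) g) f.

HB.lock Definition amap (K : fieldType) (hy hz : nat -> nat) (f : {malg K[monomial]}) :
    {malg K[monomial]} :=
  linext (fun u => << map_monomial hy hz u >>) f.

Section FreeSuperalgebra.
Variable K : fieldType.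
Notation A := {malg K[monomial]}.
Implicit Types f g h : A.

Lemma amulDl f1 f2 g : amul (f1 + f2) g = amul f1 g + amul f2 g.
Proof. by rewrite amul.unlock linearD. Qed.

Lemma amulZl c f g : amul (c *: f) g = c *: amul f g.
Proof. by rewrite amul.unlock linearZ. Qed.

Lemma amul_linear_r f c g1 g2 : amul f (c *: g1 + g2) = c *: amul f g1 + amul f g2.
Proof.
rewrite amul.unlock /linext scaler_sumr -big_split; apply: eq_bigr => u _ /=.
by rewrite -!/(linext _ _) linearP scalerDr !scalerA mulrC.
Qed.

Lemma amulDr f g1 g2 : amul f (g1 + g2) = amul f g1 + amul f g2.
Proof. by have := amul_linear_r f 1 g1 g2; rewrite !scale1r. Qed.

Lemma amulZr c f g : amul f (c *: g) = c *: amul f g.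
Proof.
have f0 : amul f 0 = 0 by apply: (addrI (amul f 0)); rewrite -amulDr !addr0.
by have := amul_linear_r f c g 0; rewrite f0 !addr0.
Qed.

Lemma amulUU u v : amul (K := K) << u >> << v >> = << Mul u v >>.
Proof. by rewrite amul.unlock !linextU. Qed.

Lemma amap_is_linear hy hz : linear (amap (K := K) hy hz).
Proof. by rewrite amap.unlock; apply: linext_is_linear. Qed.

HB.instance Definition _ hy hz :=
  GRing.isLinear.Build K A A _ (amap hy hz) (amap_is_linear hy hz).

Lemma amapM hy hz f g :
  amap hy hz (amul f g) = amul (amap hy hz f) (amap hy hz g).
Proof.
rewrite amap.unlock amul.unlock !linear_linext; apply: eq_linext => u.
rewrite /= linextU !linear_linext; apply: eq_linext => v.
by rewrite /= !linextU.
Qed.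

Definition homogeneous (i : bool) (f : A) :=
  forall u, u \in msupp f -> parity u = i.

Lemma homogeneous_amap hy hz i f :
  homogeneous i f -> homogeneous i (amap hy hz f).
Proof.
rewrite amap.unlock => hf u; apply: contraTeq => par_u.
rewrite -mcoeff_eq0 raddf_sum big_seq.
apply/eqP/big1 => v vf; rewrite /= mcoeffZ mcoeffU.
case: eqP => [eq_u|_]; last by rewrite mulr0n mulr0.
by rewrite -eq_u parity_map_monomial hf ?eqxx in par_u.
Qed.

(* The two-sided ideal generated by the super-identities. *)
Inductive bicomm_ideal : A -> Prop :=
| bi_left i j k f g h :
    homogeneous i f -> homogeneous j g -> homogeneous k h ->
    bicomm_ideal (amul f (amul g h) - (-1) ^+ (i && j) *: amul g (amul f h))
| bi_right i j k f g h :
    homogeneous i f -> homogeneous j g -> homogeneous k h ->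
    bicomm_ideal (amul (amul f g) h - (-1) ^+ (j && k) *: amul (amul f h) g)
| bi_0 : bicomm_ideal 0
| bi_D f g : bicomm_ideal f -> bicomm_ideal g -> bicomm_ideal (f + g)
| bi_Z c f : bicomm_ideal f -> bicomm_ideal (c *: f)
| bi_Ml f g : bicomm_ideal g -> bicomm_ideal (amul f g)
| bi_Mr f g : bicomm_ideal f -> bicomm_ideal (amul f g).

Lemma bicomm_ideal_amap hy hz f :
  bicomm_ideal f -> bicomm_ideal (amap hy hz f).
Proof.
elim=> {f} [i j k f g h fi gj hk|i j k f g h fi gj hk|
  |f g _ If _ Ig|c f _ If|f g _ Ig|f g _ If].
- rewrite linearB linearZ /= !amapM.
  by apply: (@bi_left _ _ k); apply: homogeneous_amap.
- rewrite linearB linearZ /= !amapM.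
  by apply: (@bi_right i); apply: homogeneous_amap.
- by rewrite linear0; apply: bi_0.
- by rewrite linearD; apply: bi_D.
- by rewrite linearZ; apply: bi_Z.
- by rewrite amapM; apply: bi_Ml.
- by rewrite amapM; apply: bi_Mr.
Qed.

Definition bicomm_idealb : {pred A} := fun f => `[< bicomm_ideal f >].

Lemma bicomm_idealP f : reflect (bicomm_ideal f) (f \in bicomm_idealb).
Proof. exact: asboolP. Qed.

Lemma bicomm_ideal_zmod_closed : zmod_closed bicomm_idealb.
Proof.
split=> [|f g /bicomm_idealP If /bicomm_idealP Ig]; apply/bicomm_idealP.
  exact: bi_0.
by apply: bi_D => //; rewrite -scaleN1r; apply: bi_Z.
Qed.

HB.instance Definition _ :=
  GRing.isZmodClosed.Build A bicomm_idealb bicomm_ideal_zmod_closed.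

(* The free bicommutative superalgebra. *)
Definition FB : Type := Quotient.quot bicomm_idealb.
HB.instance Definition _ := GRing.Zmodule.on FB.
HB.instance Definition _ := EqQuotient.on FB.

Definition toF (f : A) : FB := \pi_FB f.

Lemma toFP f g : toF f = toF g <-> bicomm_ideal (f - g).
Proof.
split=> [/eqP|I].
  by rewrite -Quotient.idealrBE => /bicomm_idealP.
by apply/eqP; rewrite -Quotient.idealrBE; apply/bicomm_idealP.
Qed.

Lemma toF_repr x : toF (repr x) = x.
Proof. exact: reprK. Qed.

Lemma repr_toF f : bicomm_ideal (repr (toF f) - f).
Proof. by apply/toFP; rewrite toF_repr. Qed.

Lemma toFD f g : toF (f + g) = toF f + toF g.
Proof. by rewrite /toF !piE. Qed.

Definition Fscale (c : K) (x : FB) : FB := toF (c *: repr x).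

Lemma toFZ c f : toF (c *: f) = Fscale c (toF f).
Proof. by apply/esym/toFP; rewrite -scalerBr; apply/bi_Z/repr_toF. Qed.

Lemma FscaleA a b x : Fscale a (Fscale b x) = Fscale (a * b) x.
Proof. by rewrite -[x]toF_repr -!toFZ scalerA. Qed.

Lemma Fscale1 : left_id 1 Fscale.
Proof. by move=> x; rewrite -[x]toF_repr -toFZ scale1r. Qed.

Lemma FscaleDr : right_distributive Fscale +%R.
Proof.
by move=> a x y; rewrite -[x]toF_repr -[y]toF_repr -toFD -!toFZ scalerDr toFD.
Qed.

Lemma FscaleDl x : {morph Fscale^~ x : a b / a + b}.
Proof. by move=> a b; rewrite -[x]toF_repr -!toFZ scalerDl toFD. Qed.

HB.instance Definition _ :=
  GRing.Zmodule_isLmodule.Build K FB FscaleA Fscale1 FscaleDr FscaleDl.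

Definition Fmul (x y : FB) : FB := toF (amul (repr x) (repr y)).

Lemma toFM f g : toF (amul f g) = Fmul (toF f) (toF g).
Proof.
apply/esym/toFP; set f' := repr _; set g' := repr _.
have -> : amul f' g' - amul f g = amul (f' - f) g' + amul f (g' - g).
  rewrite amulDl amulDr -!scaleN1r amulZl amulZr !scaleN1r addrA.
  by rewrite subrK.
by apply: bi_D; [apply: bi_Mr | apply: bi_Ml]; apply: repr_toF.
Qed.

Definition Fhomogeneous (i : bool) (x : FB) :=
  exists2 f, homogeneous i f & x = toF f.

Lemma Fmul_left i j k x y z :
    Fhomogeneous i x -> Fhomogeneous j y -> Fhomogeneous k z ->
  Fmul x (Fmul y z) = (-1) ^+ (i && j) *: Fmul y (Fmul x z).
Proof.
move=> [f hf ->] [g hg ->] [h hh ->]; rewrite -!toFM -[RHS]toFZ.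
by apply/toFP/(bi_left hf hg hh).
Qed.

Lemma Fmul_right i j k x y z :
    Fhomogeneous i x -> Fhomogeneous j y -> Fhomogeneous k z ->
  Fmul (Fmul x y) z = (-1) ^+ (j && k) *: Fmul (Fmul x z) y.
Proof.
move=> [f hf ->] [g hg ->] [h hh ->]; rewrite -!toFM -[RHS]toFZ.
by apply/toFP/(bi_right hf hg hh).
Qed.

Definition Fmap (hy hz : nat -> nat) (x : FB) : FB := toF (amap hy hz (repr x)).

Lemma Fmap_toF hy hz f : Fmap hy hz (toF f) = toF (amap hy hz f).
Proof.
by apply/toFP; rewrite -linearB; apply/bicomm_ideal_amap/repr_toF.
Qed.

Definition gens (p q : nat) : seq gen :=
  map inl (iota 0 p) ++ map inr (iota 0 q).

(* The multilinear component of FB in the first p even and q odd generators. *)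
Definition multilinear (p q : nat) (x : FB) :=
  exists2 f : A, (forall u, u \in msupp f -> perm_eq (leaves u) (gens p q))
               & x = toF f.

Definition perm_nat n (s : 'S_n) (i : nat) : nat :=
  oapp (fun k : 'I_n => val (s k)) i (insub i).

Definition FB_act p q (g : 'S_p * 'S_q) : FB -> FB :=
  Fmap (perm_nat g.1) (perm_nat g.2).

End FreeSuperalgebra.

(* The family of operators [act] preserves the finite-dimensional subspace [P],
   and its traces on [P] are the values of [chi]. *)
Definition has_character (K : fieldType) (V : lmodType K) (gT : Type)
    (P : V -> Prop) (act : gT -> V -> V) (chi : gT -> K) : Prop :=
  exists n (e : 'I_n -> V),
    [/\ forall x, P x <-> exists c : 'I_n -> K, x = \sum_i c i *: e i,
        forall c : 'I_n -> K, \sum_i c i *: e i = 0 -> forall i, c i = 0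
      & forall g, exists M : 'M[K]_n,
          (forall i, act g (e i) = \sum_j M i j *: e j) /\ chi g = \tr M].

(* A partition of n, padded with zeros to n parts. *)
Record intpart n := IntPart {
  intpart_tuple :> n.-tuple 'I_n.+1;
  _ : sorted geq (map val intpart_tuple) && (sumn (map val intpart_tuple) == n)
}.
HB.instance Definition _ n := [isSub for @intpart_tuple n].
HB.instance Definition _ n := [Finite of intpart n by <:].

Definition parts n (la : intpart n) : seq nat := map val la.

Definition conj_parts (s : seq nat) : seq nat :=
  mkseq (fun j => count (ltn j) s) (head 0%N s).

Section SpechtCharacter.
Variables (K : fieldType) (n : nat) (la : intpart n).

(* The stabilizers of the rows and of the columns of the tableau in which
   0, ..., n-1 are written in order along the successive rows. *)
Definition row_stab : {set 'S_n} :=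
  [set s : 'S_n | [forall k, reshape_index (parts la) (s k) == reshape_index (parts la) k]].

Definition col_stab : {set 'S_n} :=
  [set s : 'S_n | [forall k, reshape_offset (parts la) (s k) == reshape_offset (parts la) k]].

Notation aG := (regular_repr K [set: 'S_n]).

Definition young_symmetrizer : 'rV[K]_#|[set: 'S_n]| :=
  \sum_(r in row_stab) \sum_(c in col_stab) (-1) ^+ c *: gring_row (aG (r * c)%g).

(* Permutations compose from left to right here, so that the Specht module is
   the right ideal generated by the Young symmetrizer. *)
Definition specht_repr :=
  submod_repr (cyclic_mx_module aG young_symmetrizer).

Definition specht_char (s : 'S_n) : K := \tr (specht_repr s).

End SpechtCharacter.

Definition multiplicity (la mu : seq nat) : nat :=
  let mu' := conj_parts mu in
  let la1 := nth 0%N la 0 in let la2 := nth 0%N la 1 in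
  let mu'1 := nth 0%N mu' 0 in let mu'2 := nth 0%N mu' 1 in
  let deg := (sumn la + sumn mu)%N in
  if [&& nth 0%N la 2 == 0%N, nth 0%N mu' 2 == 0%N & (0 < la2 + mu'2)%N]
  then ((la1 - la2 + 1) * (mu'1 - mu'2 + 1))%N
  else if [&& (2 <= deg)%N, la2 == 0%N & mu'2 == 0%N]
  then ((la1 + 1) * (mu'1 + 1) - 2)%N
  else if deg == 1%N then 1%N
  else 0%N.

(* Main.v *)
From HB Require Import structures.
Require Import Defs.
From mathcomp Require Import all_boot all_order all_algebra all_fingroup all_character.
From mathcomp Require Import finmap monalg zify ring.
From mathcomp Require Import boolp.

(** In a bicommutative superalgebra the left multiplications supercommute, the
right multiplications supercommute, and u ((a b) c) = (u (a b)) c ([sim_assoc],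
stated here up to sign).  Hence a monomial of degree at least 2 can be brought to
a normal form l_1 (l_2 (... (((l_k r_1) r_2) ... r_m))), and up to sign it only
depends on which of its letters are left factors and which are right factors
([sim_of_perm]).  Conversely, list the letters of a monomial in order, each tagged
as a left or a right factor: both super-identities become the rule that tagged
letters supercommute.  So any function of tagged words that obeys this rule
vanishes on the ideal ([omega_ideal]), and such functions separate the colourings
of the generators by left and right.  The multilinear component thus has a basis
indexed by the colourings that some monomial realises: those that are not
constant, or a single one in degree 1.  As odd letters anticommute whatever their
tags, a pair (s, t) of permutations maps the basis vector of a colouring to
sgn t times the basis vector of the permuted colouring.  With F s the number of
subsets stable under s, its trace is sgn t (F s F t - 2), or sgn t (F s F t - 1)
in degree 1.

On the side of the symmetric groups, the claim becomes that F is the sum of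
(la_1 - la_2 + 1) chi_la over the partitions la with at most two parts, that
sgn * F is the analogous sum over partitions with at most two columns, and that
the shapes with one row and one column give 1 and sgn.  For a two-row shape
(n - k, k), the right ideal of the Young symmetrizer is carried by the
permutation module on the k-subsets, where it becomes the span of the
polytabloids.  This span is the whole kernel of the map that removes a point
([polytabloid_span]), and that map is onto the functions on (k-1)-subsets
([down_mx_full]), so chi_(n-k,k) counts stable k-subsets minus stable
(k-1)-subsets.  Both facts come from one double count ([ker_down_radial],
[up_radial]): summing the equations of the kernel over the subsets that meet a
fixed X in a given number of points yields a two-term recurrence, which determines
all radial sums around X from the value at X.  In particular an invariant operator
acts on the kernel as a scalar; the operator built from a polytabloid has its image
in the span of polytabloids and has trace n!, so its scalar is not zero and the
span is everything.  For two columns, transposing the left multiplication by the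
Young symmetrizer exchanges its two factors, which gives the sign times the
character of the conjugate shape ([trace_column_symmetrizer]). *)

Set Implicit Arguments.
Unset Strict Implicit.
Unset Printing Implicit Defensive.

Import GRing.Theory.
Local Open Scope ring_scope.

(** * Traces on row spaces *)

Section TraceOn.
Variable K : fieldType.

(** For a stable row space X, this is the trace of A on X; any basis computes it
([trace_on_basis]). *)
Definition trace_on m r (X : 'M[K]_(r, m)) (A : 'M[K]_m) : K :=
  \tr (row_base X *m A *m pinvmx (row_base X)).

Lemma trace_on_basis m r r' (X : 'M[K]_(r, m)) (U : 'M_(r', m)) (A : 'M_m) C :
  row_free U -> (U :=: X)%MS -> U *m A = C *m U -> trace_on X A = \tr C.
Proof.
move=> freeU eqUX UA; rewrite /trace_on.
have freeR := row_base_free X; have eqR := eq_row_base X.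
move: (row_base X) freeR eqR => R freeR eqR.
have [P defR] : exists P, R = P *m U by apply/submxP; rewrite eqR eqUX.
have [P' defU] : exists P', U = P' *m R by apply/submxP; rewrite eqR eqUX.
have P'P : P' *m P = 1%:M.
  by apply: (row_free_inj freeU); rewrite -mulmxA -defR -defU mul1mx.
have -> : R *m A = P *m C *m P' *m R.
  by rewrite {1}defR -(mulmxA P) UA mulmxA {1}defU mulmxA.
rewrite -[X in \tr X]mulmxA mulmxVp // mulmx1.
by rewrite mxtrace_mulC mulmxA P'P mul1mx.
Qed.

Lemma stable_basis m r (X : 'M[K]_(r, m)) A :
    (X *m A <= X)%MS ->
  exists r' (U : 'M_(r', m)) C, [/\ row_free U, (U :=: X)%MS & U *m A = C *m U].
Proof.
have eqR := eq_row_base X.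
move=> sXA; have /submxP[C defC] : (row_base X *m A <= row_base X)%MS.
  by rewrite eqR (eqmxMr _ eqR).
by exists _, (row_base X), C; rewrite row_base_free.
Qed.

Lemma eq_trace_on m r r' (X : 'M[K]_(r, m)) (Y : 'M[K]_(r', m)) A :
  (X *m A <= X)%MS -> (X :=: Y)%MS -> trace_on X A = trace_on Y A.
Proof.
move=> /stable_basis[r0 [U [C [freeU eqUX UA]]]] eqXY.
rewrite (trace_on_basis freeU eqUX UA) (trace_on_basis freeU _ UA) //.
exact: eqmx_trans eqXY.
Qed.

Lemma trace_on_inj m m' r (X : 'M[K]_(r, m)) (J : 'M_(m, m')) A B a :
    row_free J -> (X *m A <= X)%MS -> J *m B = a *: (A *m J) ->
  trace_on (X *m J) B = a * trace_on X A.
Proof.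
move=> freeJ /stable_basis[r0 [U [C [freeU eqUX UA]]]] JB.
rewrite (trace_on_basis freeU eqUX UA) -mxtraceZ.
apply: (@trace_on_basis _ _ _ _ (U *m J)).
- by rewrite /row_free mxrankMfree.
- exact: eqmxMr.
- by rewrite -scalemxAl (mulmxA C) -UA -!mulmxA JB -scalemxAr.
Qed.

(** Factor E as Z U with U a basis of its row space and Z of full rank: the same small
matrix describes A on the row space of E and A^T on the row space of E^T. *)
Lemma trace_on_tr m (E A : 'M[K]_m) :
  A *m E = E *m A -> trace_on E A = trace_on E^T A^T.
Proof.
move=> AE; have /stable_basis[r [U [C [freeU eqUE UA]]]] : (E *m A <= E)%MS.
  by rewrite -AE submxMl.
have [Z defE] : exists Z, E = Z *m U by apply/submxP; rewrite eqUE.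
have freeZ : row_free Z^T.
  rewrite /row_free mxrank_tr eqn_leq rank_leq_col /=.
  by rewrite -{1}(eqP freeU) eqUE {1}defE mxrankM_maxl.
rewrite (trace_on_basis freeU eqUE UA) -mxtrace_tr.
apply/esym/(trace_on_basis freeZ).
  rewrite {1}defE trmx_mul; apply/eqmx_sym/eqmxMfull.
  by rewrite /row_full mxrank_tr.
rewrite -!trmx_mul; congr _^T; apply: (row_free_inj freeU).
by rewrite -!mulmxA -UA -defE AE {1}defE mulmxA.
Qed.

(** The choice of a section of d splits the space into the kernel of d and a copy of
its image. *)
Lemma trace_on_ker m p (d : 'M[K]_(m, p)) A B :
  row_full d -> A *m d = d *m B -> \tr A = trace_on (kermx d) A + \tr B.
Proof.
move=> /row_fullP[s sd1] Ad.
have /stable_basis[r [U [C [freeU eqU UA]]]] : (kermx d *m A <= kermx d)%MS.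
  by apply/sub_kermxP; rewrite -mulmxA Ad mulmxA mulmx_ker mul0mx.
rewrite (trace_on_basis freeU eqU UA).
have Ud : U *m d = 0 by apply/sub_kermxP; rewrite eqU.
have [V defV] : exists V, 1%:M - d *m s = V *m U.
  apply/submxP; rewrite eqU; apply/sub_kermxP.
  by rewrite mulmxBl mul1mx -mulmxA sd1 mulmx1 subrr.
have UV : U *m V = 1%:M.
  apply: (row_free_inj freeU); rewrite mul1mx.
  by rewrite -mulmxA -defV mulmxBr mulmx1 mulmxA Ud mul0mx subr0.
have -> : A = A *m (V *m U) + A *m (d *m s).
  by rewrite -mulmxDr -defV subrK mulmx1.
rewrite mxtraceD (mulmxA A V) [in LHS]mxtrace_mulC (mulmxA U A) UA.
rewrite -[C *m U *m V]mulmxA UV mulmx1; congr (_ + _).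
by rewrite mulmxA Ad -mulmxA mxtrace_mulC -mulmxA sd1 mulmx1.
Qed.

Lemma mxtrace_square0 m (A : 'M[K]_m) : A *m A = 0 -> \tr A = 0.
Proof.
move=> AA; have [U freeU eqU] : exists2 U : 'M_(\rank A, m), row_free U & (U :=: A)%MS.
  by exists (row_base A); [exact: row_base_free | exact: eq_row_base].
have [Z defA] : exists Z, A = Z *m U by apply/submxP; rewrite eqU.
have UA : U *m A = 0.
  have /submxP[D ->] : (U <= A)%MS by rewrite eqU.
  by rewrite -mulmxA AA mulmx0.
have UZ : U *m Z = 0 by apply: (row_free_inj freeU); rewrite -mulmxA -defA UA mul0mx.
by rewrite defA mxtrace_mulC UZ mxtrace0.
Qed.

End TraceOn.

Section FMx.
Variable K : fieldType.

(** Rows and columns are indexed by the elements of two sets, so that matrix products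
read as sums over these sets. *)
Definition fmx (I J : finType) (A : {set I}) (B : {set J}) (F : I -> J -> K) :
  'M[K]_(#|A|, #|B|) := \matrix_(i, j) F (enum_val i) (enum_val j).

Lemma eq_fmx (I J : finType) (A : {set I}) (B : {set J}) F G :
  {in A & B, F =2 G} -> fmx A B F = fmx A B G.
Proof. by move=> eqFG; apply/matrixP=> i j; rewrite !mxE eqFG ?enum_valP. Qed.

Lemma fmx_inj (I J : finType) (A : {set I}) (B : {set J}) F G :
  fmx A B F = fmx A B G -> {in A & B, F =2 G}.
Proof.
move=> /matrixP eqFG i j Ai Bj.
have:= eqFG (enum_rank_in Ai i) (enum_rank_in Bj j).
by rewrite !mxE !enum_rankK_in.
Qed.

Lemma mul_fmx (I J L : finType) (A : {set I}) (B : {set J}) (C : {set L}) F G :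
  fmx A B F *m fmx B C G = fmx A C (fun i k => \sum_(j in B) F i j * G j k).
Proof.
by apply/matrixP=> i k; rewrite !mxE [RHS]big_enum_val; apply: eq_bigr => j _; rewrite !mxE.
Qed.

Lemma mxtrace_fmx (I : finType) (A : {set I}) F :
  \tr (fmx A A F) = \sum_(i in A) F i i.
Proof. by rewrite [RHS]big_enum_val; apply: eq_bigr => i _; rewrite mxE. Qed.

Lemma fmxZ (I J : finType) (A : {set I}) (B : {set J}) a F :
  a *: fmx A B F = fmx A B (fun i j => a * F i j).
Proof. by apply/matrixP=> i j; rewrite !mxE. Qed.

Lemma fmx_tr (I J : finType) (A : {set I}) (B : {set J}) F :
  (fmx A B F)^T = fmx B A (fun j i => F i j).
Proof. by apply/matrixP=> i j; rewrite !mxE. Qed.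

Lemma fmx_id (I : finType) (A : {set I}) :
  fmx A A (fun i j => (i == j)%:R) = 1%:M.
Proof. by apply/matrixP=> i j; rewrite !mxE (inj_eq enum_val_inj). Qed.

Lemma fmx_ex (I J : finType) (A : {set I}) (B : {set J}) (M : 'M_(#|A|, #|B|)) :
  exists F, M = fmx A B F.
Proof.
case: (set_0Vmem A) => [A0|[a Aa]].
  exists (fun _ _ => 0); apply/matrixP=> i.
  by have := enum_valP i; rewrite {2}A0 inE.
case: (set_0Vmem B) => [B0|[b Bb]].
  exists (fun _ _ => 0); apply/matrixP=> i j.
  by have := enum_valP j; rewrite {2}B0 inE.
exists (fun i j => M (enum_rank_in Aa i) (enum_rank_in Bb j)).
by apply/matrixP=> i j; rewrite !mxE !enum_valK_in.
Qed.
End FMx.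

(** * Subsets under permutations *)

Section SubsetAction.
Variable n : nat.
Implicit Types (A B X Y Z : {set 'I_n}) (s t : 'S_n).

Lemma imset_permM s t A : (s * t)%g @: A = t @: (s @: A).
Proof. by rewrite -imset_comp; apply: eq_imset => i; rewrite /= permM. Qed.

Lemma imset_perm1 A : (1 : 'S_n)%g @: A = A.
Proof. by rewrite -[RHS]imset_id; apply: eq_imset => i; rewrite perm1. Qed.

Lemma imset_permK s : cancel (fun A => s @: A) (fun A => s^-1%g @: A).
Proof. by move=> A; rewrite -imset_permM mulgV imset_perm1. Qed.

Lemma imset_permKV s : cancel (fun A => s^-1%g @: A) (fun A => s @: A).
Proof. by move=> A; rewrite -imset_permM mulVg imset_perm1. Qed.

Lemma card_imset_perm s A : #|s @: A| = #|A|.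
Proof. exact/card_imset/perm_inj. Qed.

Lemma mem_imset_perm s A i : (s i \in s @: A) = (i \in A).
Proof. exact/mem_imset/perm_inj. Qed.

Lemma imset_permS s A B : (s @: A \subset s @: B) = (A \subset B).
Proof.
apply/idP/idP=> [sAB|]; last exact: imsetS.
by apply/subsetP=> i Ai; rewrite -(mem_imset_perm s) (subsetP sAB) ?mem_imset_perm.
Qed.

(** Colour the points by their membership in A and in B; both colourings have the same
number of points of each colour, so that one is a rearrangement of the other. *)
Lemma pair_transitive A B A' B' :
    #|A| = #|A'| -> #|B| = #|B'| -> #|A :&: B| = #|A' :&: B'| ->
  exists s, s @: A = A' /\ s @: B = B'.
Proof.
move=> eqA eqB eqAB.
pose col X Y := [tuple (i \in X, i \in Y) | i < n].
have cnt X Y x : count_mem x (col X Y) =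
    #|[set i | (i \in X, i \in Y) == x]|.
  rewrite count_map cardE size_filter -enumT; apply: eq_count => i.
  by rewrite !inE.
have : perm_eq (col A B) (col A' B').
  apply/allP=> x _; rewrite /= !cnt; apply/eqP; move: x => [a b].
  have reg X Y : #|[set i | (i \in X, i \in Y) == (a, b)]| =
      if a then if b then #|X :&: Y| else (#|X| - #|X :&: Y|)%N
      else if b then (#|Y| - #|X :&: Y|)%N else (n - (#|X| + #|Y| - #|X :&: Y|))%N.
    case: a b => [] [] /=.
    - by apply: eq_card => i; rewrite !inE xpair_eqE !eqb_id.
    - rewrite -cardsD; apply: eq_card => i; rewrite !inE xpair_eqE eqb_id eqbF_neg.
      by rewrite andbC.
    - rewrite setIC -cardsD; apply: eq_card => i; rewrite !inE xpair_eqE eqb_id eqbF_neg.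
      by [].
    - rewrite -cardsU -[X in (X - _)%N](card_ord n) -[in RHS](setCK (X :|: Y)) -cardsCs.
      by apply: eq_card => i; rewrite !inE xpair_eqE !eqbF_neg negb_or.
  by rewrite !reg eqA eqB eqAB.
case/tuple_permP=> s eqs.
have eqcol i : (i \in A, i \in B) = (s i \in A', s i \in B').
  have := congr1 (fun u => nth (false, false) u i) eqs.
  by rewrite -!tnth_nth !tnth_mktuple.
by exists s; split; apply/setP=> i; rewrite -[i](permKV s) mem_imset_perm;
   case: (eqcol ((s^-1)%g i)) => eA eB; rewrite ?eA ?eB permKV.
Qed.

Lemma sum_lower (V : nmodType) (F : {set 'I_n} -> V) Z :
  \sum_(Y : {set 'I_n} | (#|Y|.+1 == #|Z|) && (Y \subset Z)) F Y = \sum_(a in Z) F (Z :\ a).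
Proof.
rewrite -(@big_imset _ _ _ _ _ (fun a => Z :\ a) Z F) /=; last first.
  move=> a b Za Zb eqab; apply/eqP; have := setD11 b Z.
  by rewrite -eqab !inE Zb andbT eq_sym => /negbFE.
apply: eq_bigl => Y; apply/andP/imsetP=> [[/eqP cY sYZ]|[a Za ->]].
  have /cards1P[a defa] : #|Z :\: Y| == 1%N.
    by rewrite cardsD (setIidPr sYZ) -cY subSnn.
  have : a \in Z :\: Y by rewrite defa set11.
  rewrite inE => /andP[_ Za]; exists a => //.
  by rewrite -defa setDDr setDv set0U (setIidPr sYZ).
by rewrite [#|Z|](cardsD1 a) Za subD1set.
Qed.

Lemma sum_upper (V : nmodType) (F : {set 'I_n} -> V) Y :
  \sum_(Z : {set 'I_n} | (#|Z| == #|Y|.+1) && (Y \subset Z)) F Z = \sum_(a in ~: Y) F (a |: Y).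
Proof.
rewrite (reindex_inj (@setC_inj _)) /=.
rewrite (eq_bigr (fun a => F (~: (~: Y :\ a)))); last first.
  by move=> a _; rewrite setCD setCK setUC.
rewrite -(sum_lower (fun Z => F (~: Z))); apply: eq_bigl => Z.
rewrite -setCS setCK; congr (_ && _).
have := cardsC Z; have := cardsC Y; rewrite !card_ord.
move=> cY cZ; rewrite -(eqn_add2l #|Z|) cZ -[RHS](eqn_add2l #|Y|) cY.
by rewrite !addnS addnC eq_sym.
Qed.

Lemma card_setD1I X Z a :
  a \in Z -> #|(Z :\ a) :&: X| = (#|Z :&: X| - (a \in X))%N.
Proof.
move=> Za; rewrite (cardsD1 a (Z :&: X)) inE Za addKn.
by apply: eq_card => i; rewrite !inE andbA.
Qed.

Lemma card_setU1I X Y a :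
  a \notin Y -> #|(a |: Y) :&: X| = (#|Y :&: X| + (a \in X))%N.
Proof.
move=> Ya; rewrite (cardsD1 a ((a |: Y) :&: X)) !inE eqxx addnC.
congr (_ + _)%N; apply: eq_card => i; rewrite !inE.
by case: eqP => // ->; rewrite (negbTE Ya).
Qed.

Variable K : fieldType.

Definition ksets k := [set A : {set 'I_n} | #|A| == k].
(** For k = 0 there are none, which makes the functions on (k-1)-subsets the zero
space. *)
Definition lower_sets k := [set A : {set 'I_n} | #|A|.+1 == k].

(** The map that sends a k-subset to the sum of its subsets with one point less, as
row vectors are multiplied on the left. *)
Definition down_mx k : 'M[K]_(#|ksets k|, #|lower_sets k|) :=
  fmx _ _ (fun A B => (B \subset A)%:R).

Definition set_mx (P : {set {set 'I_n}}) s : 'M[K]_#|P| :=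
  fmx P P (fun A B => (B == s @: A)%:R).

Lemma down_mx_equivariant k s :
  set_mx (ksets k) s *m down_mx k = down_mx k *m set_mx (lower_sets k) s.
Proof.
rewrite !mul_fmx; apply: eq_fmx => A B; rewrite !inE => cA cB.
rewrite (bigD1 (s @: A)) ?inE ?card_imset_perm //= eqxx mul1r big1 ?addr0; last first.
  by move=> X /andP[_ /negbTE->]; rewrite mul0r.
rewrite (bigD1 (s^-1%g @: B)) ?inE ?card_imset_perm //= imset_permKV eqxx mulr1.
rewrite -[in RHS](imset_permS s) imset_permKV [X in _ + X]big1 ?addr0 // => X /andP[_ /negbTE nX].
by case: eqP => [defB|_]; rewrite ?mulr0 //; rewrite defB imset_permK eqxx in nX.
Qed.

Lemma mxtrace_set_mx (P : {set {set 'I_n}}) s :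
  \tr (set_mx P s) = #|[set A in P | s @: A == A]|%:R.
Proof.
rewrite mxtrace_fmx -sum1_card natr_sum big_mkcond /= [RHS]big_mkcond /=.
by apply: eq_bigr => A _; rewrite inE eq_sym; case: (A \in P); case: eqP.
Qed.

Section Radial.
Hypothesis charK : [pchar K] =i pred0.
Variables (k : nat) (f : {set 'I_n} -> K).

Let natr_neq0 m : (m%:R == 0 :> K) = (m == 0%N).
Proof. by move/pcharf0P: charK => ->. Qed.

Lemma sum_bool_const (P : {set 'I_n}) (b : bool) (c : K) :
  \sum_(a in P) (if b then c else 0) = if b then #|P|%:R * c else 0.
Proof. by case: b; [rewrite sumr_const mulr_natl | rewrite big1]. Qed.

(** Add up the equations at the sets Y that meet X in j points.  A k-subset Z contains
j+1 such Y if it meets X in j+1 points, k-j if it meets X in j points, and none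
otherwise.  This links the radial sums at j+1 and at j, and the one at k is f X. *)
Lemma ker_down_radial X (kX : #|X| = k)
    (fd : forall Y, Y \in lower_sets k -> \sum_(Z in ksets k) f Z * (Y \subset Z)%:R = 0) i :
  (i <= k)%N ->
  \sum_(Z in ksets k | #|Z :&: X| == (k - i)%N) f Z = (-1) ^+ i * 'C(k, i)%:R * f X.
Proof.
pose E j := \sum_(Z in ksets k | #|Z :&: X| == j) f Z.
have rec j : (j < k)%N -> j.+1%:R * E j.+1 + (k - j)%:R * E j = 0.
  move=> ltjk.
  have <- : \sum_(Y in lower_sets k | #|Y :&: X| == j)
      \sum_(Z in ksets k) f Z * (Y \subset Z)%:R = 0.
    by rewrite big1 // => Y /andP[/fd].
  rewrite exchange_big /= !mulr_sumr [in X in X + _]big_mkcondr [in X in _ + X]big_mkcondr.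
  rewrite -big_split /=; apply: eq_bigr => Z; rewrite inE => /eqP cZ.
  transitivity (\sum_(a in Z) (if #|(Z :\ a) :&: X| == j then f Z else 0)).
    rewrite (big_setID X) /=.
    rewrite (eq_bigr (fun=> if #|Z :&: X| == j.+1 then f Z else 0)); last first.
      move=> a; rewrite inE => /andP[Za Xa]; rewrite card_setD1I // Xa subn1.
      by rewrite (cardsD1 a) !inE Za Xa.
    rewrite [X in _ = _ + X](eq_bigr (fun=> if #|Z :&: X| == j then f Z else 0)); last first.
      by move=> a; rewrite inE => /andP[/negbTE Xa Za]; rewrite card_setD1I // Xa subn0.
    rewrite !sum_bool_const cardsD cZ.
    by congr (_ + _); case: eqP => // ->.
  rewrite -(sum_lower (fun Y => if #|Y :&: X| == j then f Z else 0)) cZ.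
  rewrite [LHS]big_mkcond [RHS]big_mkcond; apply: eq_bigr => Y _; rewrite inE.
  by case: (_ == k); case: (_ \subset _); case: (_ == j); rewrite /= ?mulr1 ?mulr0.
elim: i => [_|i IHi ltik].
  rewrite subn0 bin0 mul1r mul1r (bigD1 X) /= ?inE ?kX ?setIid ?kX ?eqxx //.
  rewrite big1 ?addr0 // => Z /andP[/andP[]]; rewrite inE => /eqP cZ /eqP cZX.
  have /eqP ZX : Z :&: X == Z by rewrite eqEcard subsetIl cZX cZ /=.
  have /eqP XZ : Z :&: X == X by rewrite eqEcard subsetIr cZX kX /=.
  by rewrite -ZX XZ eqxx.
have /rec : (k - i.+1 < k)%N by rewrite ltn_subrL /= (leq_ltn_trans _ ltik).
rewrite -/(E _) -subSn // subSS subKn // /E IHi ?(ltnW ltik) // => /eqP.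
rewrite addrC addr_eq0 => /eqP eqE.
have nz : i.+1%:R != 0 :> K by rewrite natr_neq0.
have bin_rec : i.+1%:R * 'C(k, i.+1)%:R = (k - i)%:R * 'C(k, i)%:R :> K.
  by rewrite -!natrM mul_bin_left.
apply: (mulfI nz); rewrite eqE exprS mulN1r mulNr mulNr mulrN; congr (- _).
have comm (a b c d : K) : a * (b * c * d) = b * (a * c) * d by ring.
by rewrite [RHS]comm bin_rec [LHS]comm.
Qed.

(** The same count for the transposed map: now the radial sum at 0 comes with the nonzero
factor n - 2 #|X|, so it vanishes, and the recurrence propagates this to all the
others. *)
Lemma up_radial X (kX : #|X|.+1 = k) (lt_kn : (k + #|X| < n.+1)%N)
    (fu : forall Z, Z \in ksets k -> \sum_(Y in lower_sets k) f Y * (Y \subset Z)%:R = 0) i :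
  \sum_(Y in lower_sets k | #|Y :&: X| == i) f Y = 0.
Proof.
pose m := #|X|; pose E j := \sum_(Y in lower_sets k | #|Y :&: X| == j) f Y.
have rec j : (j <= m)%N -> (if j is j'.+1 then (m - j')%:R * E j' else 0)
    + (n - (m + m - j))%:R * E j = 0.
  move=> lejm.
  have -> : (if j is j'.+1 then (m - j')%:R * E j' else 0)
    = \sum_(Y in lower_sets k) if #|Y :&: X|.+1 == j then (m - #|Y :&: X|)%:R * f Y else 0.
    case: j lejm => [|j] lejm; first by rewrite big1.
    rewrite mulr_sumr big_mkcondr; apply: eq_bigr => Y _.
    by rewrite eqSS; case: eqP => // ->.
  have sum0 : \sum_(Z in ksets k | #|Z :&: X| == j)
      \sum_(Y in lower_sets k) f Y * (Y \subset Z)%:R = 0.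
    by rewrite big1 // => Z /andP[/fu].
  rewrite -[RHS]sum0 exchange_big /=.
  transitivity (\sum_(Y in lower_sets k)
     \sum_(a in ~: Y) (if #|(a |: Y) :&: X| == j then f Y else 0)).
    rewrite mulr_sumr big_mkcondr -big_split /=; apply: eq_bigr => Y; rewrite inE => /eqP cY.
    have {}cY : #|Y| = m by apply: succn_inj; rewrite cY kX.
    rewrite (big_setID X) /=.
    rewrite (eq_bigr (fun=> if #|Y :&: X|.+1 == j then f Y else 0)); last first.
      by move=> a; rewrite !inE => /andP[Ya Xa]; rewrite card_setU1I // Xa addn1.
    rewrite [X in _ = _ + X](eq_bigr (fun=> if #|Y :&: X| == j then f Y else 0)); last first.
      by move=> a; rewrite !inE => /andP[/negbTE Xa Ya]; rewrite card_setU1I // Xa addn0.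
    rewrite !sum_bool_const; congr (_ + _); case: eqP => // cYX.
      by rewrite (setIC (~: Y)) -setDE cardsD (setIC X).
    by rewrite setDE -setCU cardsCs setCK cardsU cY cYX card_ord.
  apply: eq_bigr => Y; rewrite inE => /eqP cY.
  rewrite -(sum_upper (fun Z => if #|Z :&: X| == j then f Y else 0)) cY.
  rewrite [LHS]big_mkcond [RHS]big_mkcond; apply: eq_bigr => Z _; rewrite inE.
  by case: (_ == k); case: (_ \subset _); case: (_ == j); rewrite /= ?mulr1 ?mulr0.
have [lim|lemi] := leqP i m; last first.
  rewrite big1 // => Y /andP[_ /eqP cYX].
  by have := subset_leq_card (subsetIr Y X); rewrite cYX leqNgt lemi.
have coef j : (j <= m)%N -> (n - (m + m - j))%:R != 0 :> K.
  move=> lejm; rewrite natr_neq0 subn_eq0 -ltnNge.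
  by rewrite (leq_ltn_trans (leq_subr _ _)) //; move: lt_kn; rewrite -kX.
rewrite -/(E i); elim: i lim => [_|i IHi lim].
  have /eqP := rec 0%N isT; rewrite add0r mulf_eq0 (negbTE (coef _ _)) //=.
  by move/eqP.
have /eqP := rec _ lim; rewrite IHi ?(ltnW lim) // mulr0 add0r mulf_eq0.
by rewrite (negbTE (coef _ _)) //= => /eqP.
Qed.
End Radial.

(** The transposed map is injective: if f is in its kernel, f X is the radial sum over
the sets that contain X, which is 0 by [up_radial]. *)
Lemma down_mx_full (charK : [pchar K] =i pred0) k : (2 * k <= n)%N -> row_full (down_mx k).
Proof.
move=> le2kn; rewrite /row_full -mxrank_tr -/(row_free _) -kermx_eq0.
have [F defF] := fmx_ex (kermx (down_mx k)^T).
have : kermx (down_mx k)^T *m (down_mx k)^T = 0 := mulmx_ker _.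
have -> : 0 = fmx (lower_sets k) (ksets k) (fun _ _ => 0 : K).
  by apply/matrixP=> i j; rewrite !mxE.
rewrite defF fmx_tr mul_fmx => /fmx_inj FD; apply/eqP/matrixP=> i j; rewrite !mxE.
set X := enum_val j; have := enum_valP j; rewrite inE -/X => /eqP cX.
have := @up_radial charK k (F (enum_val i)) X cX.
have -> : (k + #|X| < n.+1)%N.
  by rewrite ltnS (leq_trans _ le2kn) // mul2n -addnn leq_add2l -cX.
move=> /(_ isT _ #|X|) H; rewrite -[RHS]H => [|Z Zk]; last first.
  by apply: FD => //; apply: enum_valP.
rewrite (bigD1 X) /= ?inE ?cX ?setIid ?eqxx //.
rewrite big1 ?addr0 // => Z /andP[/andP[]]; rewrite inE => /eqP cZ /eqP cZX.
have {}cZ : #|Z| = #|X| by apply: succn_inj; rewrite cZ.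
have /eqP ZX : Z :&: X == Z by rewrite eqEcard subsetIl cZX cZ /=.
have /eqP XZ : Z :&: X == X by rewrite eqEcard subsetIr cZX /=.
by rewrite -ZX XZ eqxx.
Qed.

End SubsetAction.

(** * Polytabloids of two-row shapes *)

(** The two-row tableau is described by its second row B0 and by labels that are equal
exactly on the two entries of a column.  This form also covers the tableaux with two
columns, with rows as labels. *)
Section Polytabloid.
Variables (K : fieldType) (n : nat) (B0 : {set 'I_n}) (f : 'I_n -> nat).
Hypothesis charK : [pchar K] =i pred0.
Hypothesis pos_inj : forall i j, (i \in B0) = (j \in B0) -> f i = f j -> i = j.
Hypothesis partner : forall i, i \in B0 -> exists2 j, j \notin B0 & f j = f i.
Implicit Types (A B X Y Z : {set 'I_n}) (s t x : 'S_n).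

Let k := #|B0|.

Definition label_stab : {set 'S_n} := [set c : 'S_n | [forall i, f (c i) == f i]].

Lemma label_stabP (c : 'S_n) : reflect (forall i, f (c i) = f i) (c \in label_stab).
Proof. by rewrite inE; apply: (iffP forallP) => [H i|H i]; apply/eqP/H. Qed.

(** The coefficient of the subset Z in the signed sum of the images of B0 under the
permutations that preserve the columns. *)
Definition polytabloid Z : K :=
  \sum_(c in label_stab) (-1) ^+ c *+ (Z == c @: B0).

Lemma double_card_le : (2 * k <= n)%N.
Proof.
pose h i := odflt i [pick j | (j \notin B0) && (f j == f i)].
have hP i : i \in B0 -> h i \notin B0 /\ f (h i) = f i.
  rewrite /h; case: pickP => [j /andP[Bj /eqP fj] //|no /partner[j Bj fj]].
  by have := no j; rewrite Bj fj eqxx.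
have hinj : {in B0 &, injective h}.
  move=> i j Bi Bj eqh; apply: pos_inj; first by rewrite Bi Bj.
  by rewrite -(hP i Bi).2 -(hP j Bj).2 eqh.
have sub : h @: B0 \subset ~: B0.
  by apply/subsetP=> _ /imsetP[i /hP[Bhi _] ->]; rewrite inE.
have := subset_leq_card sub; rewrite card_in_imset // => le_kC.
by rewrite -[n in leqRHS]card_ord -(cardsC B0) mul2n -addnn leq_add2l.
Qed.

Lemma polytabloid1 : polytabloid B0 = 1.
Proof.
rewrite /polytabloid (bigD1 1%g) /=; last by apply/label_stabP=> i; rewrite perm1.
rewrite imset_perm1 eqxx odd_perm1 big1 ?addr0 // => c /andP[/label_stabP fc c1].
case: eqP => // eqB; case/eqP: c1; apply/permP=> i; rewrite perm1.
by apply: pos_inj => //; rewrite {1}eqB mem_imset_perm.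
Qed.

Lemma polytabloid_alt c Z :
  c \in label_stab -> polytabloid (c @: Z) = (-1) ^+ c * polytabloid Z.
Proof.
move=> Cc; rewrite /polytabloid mulr_sumr (reindex_inj (mulIg c)) /=.
apply: eq_big => [e|e _].
  apply/label_stabP/label_stabP=> fe i; last by rewrite permM (label_stabP _ Cc).
  by have := fe i; rewrite permM (label_stabP _ Cc).
rewrite imset_permM (inj_eq (can_inj (imset_permK c))) odd_permM signr_addb.
by rewrite mulrC -mulrnAr.
Qed.

(** Some pair of partners avoids Y, as Y has fewer than #|B0| points; swapping them
negates the polytabloid and preserves Y. *)
Lemma polytabloid_down Y : Y \in lower_sets n k ->
  \sum_(Z in ksets n k) polytabloid Z * (Y \subset Z)%:R = 0.
Proof.
rewrite inE => /eqP cY.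
have [i [j [Bi Bj fj Yi Yj]]] : exists i j,
    [/\ i \in B0, j \notin B0, f j = f i, i \notin Y & j \notin Y].
  apply: contrapT => no.
  pose h i := if i \in Y then i else odflt i [pick j | (j \in Y) && (f j == f i)].
  have hP i : i \in B0 -> h i \in Y /\ f (h i) = f i.
    rewrite /h => Bi; case: ifP => // nYi.
    case: pickP => [j /andP[Yj /eqP fj] //|none].
    have [j Bj fj] := partner Bi.
    case: no; exists i, j; split; rewrite ?nYi //.
    by have := none j; rewrite fj eqxx andbT => ->.
  have hinj : {in B0 &, injective h}.
    move=> i j Bi Bj eqh; apply: pos_inj; first by rewrite Bi Bj.
    by rewrite -(hP i Bi).2 -(hP j Bj).2 eqh.
  have sub : h @: B0 \subset Y by apply/subsetP=> _ /imsetP[i /hP[Yhi _] ->].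
  by have := subset_leq_card sub; rewrite card_in_imset // -/k -cY ltnn.
pose c := tperm i j.
have Cc : c \in label_stab.
  by apply/label_stabP=> a; rewrite /c; case: tpermP => [->|->|].
have cYY : c @: Y = Y.
  apply/setP=> a; rewrite -[a](permKV c) mem_imset_perm permKV tpermV.
  by rewrite /c; case: tpermP => [->|->|//]; rewrite (negbTE Yi) (negbTE Yj).
have neqij : i != j by apply: contraNneq Bj => <-.
set S := \sum_(Z in _) _.
have eqS : S = - S.
  rewrite {1}/S (reindex_inj (can_inj (imset_permK c))) /= -sumrN.
  apply: eq_big => [Z|Z _]; first by rewrite !inE card_imset_perm.
  rewrite polytabloid_alt // odd_tperm neqij mulN1r mulNr.
  by rewrite -{1}cYY imset_permS.
have /eqP : S + S = 0 by rewrite {1}eqS addNr.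
by rewrite -mulr2n -mulr_natl mulf_eq0 (iffLR (pcharf0P _) charK) /= => /eqP.
Qed.

Definition polytabloid_mx : 'M[K]_(#|[set: 'S_n]|, #|ksets n k|) :=
  fmx _ _ (fun x X => polytabloid (x^-1%g @: X)).

Lemma polytabloid_mx_down : polytabloid_mx *m down_mx n K k = 0.
Proof.
rewrite mul_fmx; apply/matrixP=> i j; rewrite !mxE.
set x := enum_val i; set Y := enum_val j.
have Yk : Y \in lower_sets n k by apply: enum_valP.
rewrite (reindex_inj (can_inj (imset_permK x))) /=.
rewrite -[RHS](@polytabloid_down (x^-1%g @: Y)); last by rewrite !inE card_imset_perm in Yk *.
apply: eq_big => [Z|Z _]; first by rewrite !inE card_imset_perm.
by rewrite imset_permK -{1}(imset_permKV x Y) imset_permS.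
Qed.

(** The kernel of the operator that replaces a subset A by the sum of the polytabloids of
all the tableaux with second row A. *)
Definition radial_kernel A X : K :=
  \sum_(x : 'S_n | x @: B0 == A) polytabloid (x^-1%g @: X).

Lemma radial_kernelJ s A X : radial_kernel (s @: A) (s @: X) = radial_kernel A X.
Proof.
rewrite /radial_kernel (reindex_inj (mulIg s)) /=.
apply: eq_big => [x|x _]; first by rewrite imset_permM (inj_eq (can_inj (imset_permK s))).
by rewrite invMg imset_permM imset_permK.
Qed.

Definition kernel_mx : 'M[K]_#|ksets n k| := fmx _ _ radial_kernel.

Lemma kernel_mx_sub : (kernel_mx <= polytabloid_mx)%MS.
Proof.
apply/submxP; exists (fmx _ _ (fun A x => (x @: B0 == A)%:R)).
rewrite mul_fmx; apply: eq_fmx => A X _ _; rewrite /radial_kernel big_mkcond /=.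
rewrite [RHS](eq_bigl xpredT) => [|x]; last by rewrite inE.
by apply: eq_bigr => x _; case: eqP => _; rewrite ?mul1r ?mul0r.
Qed.

(** Each permutation contributes the coefficient of B0 in its own polytabloid, which is 1. *)
Lemma mxtrace_kernel_mx : \tr kernel_mx = n`!%:R.
Proof.
rewrite mxtrace_fmx /radial_kernel (exchange_big_dep xpredT) //=.
rewrite (eq_bigr (fun=> 1)) => [|x _].
  by rewrite sumr_const cardE -cardE card_Sn.
rewrite (big_pred1 (x @: B0)) => [|A].
  by rewrite imset_permK polytabloid1.
rewrite inE [RHS]eq_sym andb_idl // => /eqP <-.
by rewrite card_imset_perm.
Qed.

(** An invariant kernel only depends on the size of the intersection, so on the kernel of
the down map the radial sums make it a scalar.  If this scalar were 0, the square of the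
operator would vanish, since its image lies in that kernel; this contradicts its trace
n!. *)
Lemma kernel_mx_scalar : exists2 c : K, c != 0 &
  forall r (F : 'M_(r, _)), F *m down_mx n K k = 0 -> F *m kernel_mx = c *: F.
Proof.
(* psi j is the value of the kernel at any two k-subsets with j common points. *)
pose psi j : K := if [pick p : {set 'I_n} * {set 'I_n} | [&& p.1 \in ksets n k,
  p.2 \in ksets n k & #|p.1 :&: p.2| == j]] is Some p then radial_kernel p.1 p.2 else 0.
have radial A X : A \in ksets n k -> X \in ksets n k ->
    radial_kernel A X = psi #|A :&: X|.
  rewrite /psi => Ak Xk; case: pickP => [[A' X'] /= /and3P[]|/(_ (A, X))]; last first.
    by rewrite Ak Xk eqxx.
  rewrite !inE in Ak Xk *; move: Ak Xk => /eqP cA /eqP cX /eqP cA' /eqP cX' /eqP cI.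
  have [s [<- <-]] := @pair_transitive n A X A' X' (etrans cA (esym cA'))
    (etrans cX (esym cX')) (esym cI).
  by rewrite radial_kernelJ.
pose c := \sum_(i < k.+1) psi (k - i)%N * ((-1) ^+ i * 'C(k, i)%:R).
have scal r (F : 'M_(r, _)) : F *m down_mx n K k = 0 -> F *m kernel_mx = c *: F.
  move=> Fd; apply/matrixP=> i j; rewrite !mxE.
  (* g is the i-th row of F as a function of subsets, extended by 0. *)
  pose g Z := if Z \in ksets n k =P true is ReflectT Zk then F i (enum_rank_in Zk Z) else 0.
  have gE z : g (enum_val z) = F i z.
    rewrite /g; case: eqP => [Zk|]; last by case; apply: enum_valP.
    by rewrite enum_valK_in.
  set X := enum_val j; have Xk : X \in ksets n k by apply: enum_valP.
  have cX : #|X| = k by apply/eqP; rewrite inE in Xk.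
  have gd Y : Y \in lower_sets n k -> \sum_(Z in ksets n k) g Z * (Y \subset Z)%:R = 0.
    move=> Yk; have /matrixP/(_ i (enum_rank_in Yk Y)) := Fd.
    rewrite !mxE => Fd0; rewrite -[RHS]Fd0 [LHS]big_enum_val; apply: eq_bigr => z _.
    by rewrite gE mxE enum_rankK_in.
  have rad := @ker_down_radial n K charK k g X cX gd.
  transitivity (\sum_(Z in ksets n k) g Z * psi #|Z :&: X|).
    rewrite [RHS]big_enum_val; apply: eq_bigr => z _; rewrite gE mxE radial //.
    exact: enum_valP.
  transitivity (\sum_(i < k.+1) \sum_(Z in ksets n k | #|Z :&: X| == (k - i)%N)
      psi (k - i)%N * g Z).
    rewrite (exchange_big_dep (fun Z => Z \in ksets n k)) /=; last by move=> ? ? _ /andP[].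
    apply: eq_bigr => Z; rewrite inE => /eqP cZ.
    have leZ : (#|Z :&: X| <= k)%N by rewrite -cZ subset_leq_card ?subsetIl.
    have lt : (k - #|Z :&: X| < k.+1)%N by rewrite ltnS leq_subr.
    rewrite (big_pred1 (Ordinal lt)) /=; first by rewrite subKn // mulrC.
    move=> a; rewrite inE cZ eqxx /= -val_eqE /=.
    have := ltn_ord a; move: leZ; clear; set z := #|_|; case: (val a) => [|b]; lia.
  rewrite /c mulr_suml -gE -/X; apply: eq_bigr => a _.
  have leak : (a <= k)%N by rewrite -ltnS.
  by rewrite -mulr_sumr (rad a leak) !mulrA.
exists c => //; apply/eqP=> c0.
have QQ : kernel_mx *m kernel_mx = 0.
  rewrite scal ?c0 ?scale0r //; have /submxP[D ->] := kernel_mx_sub.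
  by rewrite -mulmxA polytabloid_mx_down mulmx0.
have /eqP := mxtrace_square0 QQ; rewrite mxtrace_kernel_mx (iffLR (pcharf0P _) charK).
by rewrite (gtn_eqF (fact_gt0 n)).
Qed.

(** The radial operator is a nonzero multiple of the identity on the kernel, and its
image consists of combinations of polytabloids. *)
Lemma polytabloid_span : (polytabloid_mx :=: kermx (down_mx n K k))%MS.
Proof.
apply/eqmxP/andP; split; first exact/sub_kermxP/polytabloid_mx_down.
have [c c0 scal] := kernel_mx_scalar.
have := scal _ _ (mulmx_ker (down_mx n K k)) => eqF.
rewrite -(eqmx_scale _ c0) -eqF; exact: submx_trans (submxMl _ _) kernel_mx_sub.
Qed.

Lemma polytabloid_stable s :
  (polytabloid_mx *m set_mx K (ksets n k) s <= polytabloid_mx)%MS.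
Proof.
rewrite polytabloid_span; apply/sub_kermxP.
by rewrite -mulmxA down_mx_equivariant mulmxA polytabloid_mx_down mul0mx.
Qed.

Lemma trace_on_polytabloid s :
  trace_on polytabloid_mx (set_mx K (ksets n k) s) =
    #|[set A in ksets n k | s @: A == A]|%:R - #|[set A in lower_sets n k | s @: A == A]|%:R.
Proof.
have eqd := down_mx_equivariant K k s.
have := trace_on_ker (down_mx_full charK double_card_le) eqd.
rewrite !mxtrace_set_mx => ->; rewrite addrK.
exact: eq_trace_on (polytabloid_stable s) polytabloid_span.
Qed.
End Polytabloid.

(** * Right ideals of the group ring *)

Section RegularRepr.
Variables (K : fieldType) (n : nat).
Implicit Types x z g : 'S_n.

Notation aG := (regular_repr K [set: 'S_n]).

(** The element of the group ring with coefficients phi. *)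
Definition gvec (phi : 'S_n -> K) : 'rV[K]_#|[set: 'S_n]| := \row_j phi (enum_val j).

Lemma regular_fmx g : aG g = fmx [set: 'S_n] [set: 'S_n] (fun x z => (z == x * g)%g%:R).
Proof.
apply/matrixP=> i j; rewrite !mxE /=; congr (nat_of_bool _)%:R.
by rewrite -(inj_eq enum_val_inj) gring_indexK ?inE.
Qed.

Lemma regular_tr g : (aG g)^T = aG g^-1%g.
Proof.
rewrite !regular_fmx fmx_tr; apply: eq_fmx => x z _ _; congr (nat_of_bool _)%:R.
by rewrite eq_sym -[LHS](inj_eq (mulIg g^-1%g)) mulgK eq_sym.
Qed.

Lemma gvec_regular phi g : gvec phi *m aG g = gvec (fun z => phi (z * g^-1)%g).
Proof.
apply/rowP=> j; rewrite regular_fmx !mxE; set z := enum_val j.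
transitivity (\sum_(x in [set: 'S_n]) phi x * (z == x * g)%g%:R).
  by rewrite [RHS]big_enum_val; apply: eq_bigr => i _; rewrite !mxE.
rewrite (bigD1 (z * g^-1)%g) ?inE //= mulgKV eqxx mulr1 big1 ?addr0 // => x /andP[_ /negbTE nx].
by case: eqP => [zE|_]; rewrite ?mulr0 //; rewrite zE mulgK eqxx in nx.
Qed.

(** Its row x is gvec phi multiplied by x, so that its row space is the right ideal
generated by gvec phi. *)
Definition left_mul_mx (phi : 'S_n -> K) :=
  fmx [set: 'S_n] [set: 'S_n] (fun x z => phi (z * x^-1)%g).

(** Left and right multiplications commute. *)
Lemma left_mul_mxC phi g : aG g *m left_mul_mx phi = left_mul_mx phi *m aG g.
Proof.
rewrite regular_fmx !mul_fmx; apply: eq_fmx => x z _ _.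
rewrite (bigD1 (x * g)%g) ?inE //= eqxx mul1r big1 ?addr0; last first.
  by move=> y /andP[_ /negbTE->]; rewrite mul0r.
rewrite (bigD1 (z * g^-1)%g) ?inE //= mulgKV eqxx mulr1 big1 ?addr0; last first.
  by move=> y /andP[_ /negbTE ny]; case: eqP => [zE|_]; rewrite ?mulr0 //; rewrite zE mulgK eqxx in ny.
by rewrite invMg mulgA.
Qed.

Lemma cyclic_left_mul phi : (cyclic_mx aG (gvec phi) :=: left_mul_mx phi)%MS.
Proof.
have rowE i : row i (left_mul_mx phi) = gvec phi *m aG (enum_val i).
  by rewrite gvec_regular; apply/rowP=> j; rewrite !mxE.
apply/eqmxP/andP; split.
  apply: cyclic_mx_sub.
    by apply/mxmoduleP=> g _; rewrite -left_mul_mxC submxMl.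
  have <- : row (gring_index [set: 'S_n] 1%g) (left_mul_mx phi) = gvec phi.
    by rewrite rowE gring_indexK ?inE // repr_mx1 mulmx1.
  exact: row_sub.
apply/row_subP=> i; rewrite rowE; apply: mxmodule_trans.
- exact: cyclic_mx_module.
- by rewrite inE.
- exact: cyclic_mx_id.
Qed.

Lemma trace_submod (U : 'M_#|[set: 'S_n]|) (modU : mxmodule aG U) g :
  \tr (submod_repr modU g) = trace_on U (aG g).
Proof.
apply/esym; apply: (@trace_on_basis _ _ _ _ _ (val_submod (U:=U) 1%:M)).
- by rewrite /row_free val_submod1.
- exact: val_submod1.
- by rewrite -val_submodJ ?inE // mul1mx val_submodE.
Qed.

Lemma gring_row_gvec (A B : {set 'S_n}) (a : 'S_n -> 'S_n -> K) :
  \sum_(r in A) \sum_(c in B) a r c *: gring_row (aG (r * c)%g) =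
  gvec (fun z => \sum_(r in A) \sum_(c in B) a r c *+ (z == r * c)%g).
Proof.
apply/rowP=> j; rewrite !mxE summxE; apply: eq_bigr => r _.
rewrite summxE; apply: eq_bigr => c _.
rewrite !mxE /= gring_indexK ?inE // mul1g -[RHS]mulr_natr; congr (_ * _%:R).
by rewrite -(inj_eq enum_val_inj) gring_indexK ?inE.
Qed.
End RegularRepr.

Section TwoRowSymmetrizer.
Variables (K : fieldType) (n : nat) (B0 : {set 'I_n}) (f : 'I_n -> nat).
Hypothesis charK : [pchar K] =i pred0.
Hypothesis pos_inj : forall i j, (i \in B0) = (j \in B0) -> f i = f j -> i = j.
Hypothesis partner : forall i, i \in B0 -> exists2 j, j \notin B0 & f j = f i.
Let k := #|B0|.

Notation aG := (regular_repr K [set: 'S_n]).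
Notation C := (label_stab f).
Notation ptab := (polytabloid K B0 f).

Definition set_stab : {set 'S_n} := [set s : 'S_n | s @: B0 == B0].

Definition fixed_diff (g : 'S_n) : K :=
  #|[set A in ksets n k | g @: A == A]|%:R - #|[set A in lower_sets n k | g @: A == A]|%:R.

Lemma fixed_diffV g : fixed_diff g^-1%g = fixed_diff g.
Proof.
have E (P : {set {set 'I_n}}) : [set A in P | g^-1%g @: A == A] = [set A in P | g @: A == A].
  apply/setP=> A; rewrite !inE; congr (_ && _).
  by rewrite -[LHS](inj_eq (can_inj (imset_permK g))) imset_permKV eq_sym.
by rewrite /fixed_diff !E.
Qed.

(** A subset X goes to the sum of the permutations that map B0 to X, taken with signs
when b is true: this embeds the permutation module on subsets, twisted by the sign if b
is true, in the regular representation. *)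
Definition lift_mx (b : bool) : 'M[K]_(#|ksets n k|, #|[set: 'S_n]|) :=
  fmx _ _ (fun X z => (-1) ^+ (b && odd_perm z) *+ (z @: B0 == X)).

Lemma lift_mx_free b : row_free (lift_mx b).
Proof.
(* h X is one permutation that maps B0 to X, so evaluation at the h X inverts the lift. *)
pose h X := odflt 1%g [pick z : 'S_n | z @: B0 == X].
have hE X : X \in ksets n k -> h X @: B0 = X.
  rewrite /h inE => /eqP cX; case: pickP => [z /eqP//|none].
  have [|s [sB _]] := @pair_transitive n B0 B0 X X (esym cX) (esym cX).
    by rewrite !setIid cX.
  by have := none s; rewrite sB eqxx.
apply/row_freeP; exists (fmx _ _ (fun z X => (-1) ^+ (b && odd_perm z) *+ (z == h X))).
rewrite mul_fmx -fmx_id; apply: eq_fmx => X X' Xk X'k.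
rewrite (bigD1 (h X')) ?inE //= eqxx hE // big1 ?addr0; last first.
  by move=> z /andP[_ /negbTE->]; rewrite mulr0.
by rewrite eq_sym; case: eqP => _; rewrite ?mul0r // -expr2 sqrr_sign.
Qed.

Lemma lift_mx_equivariant b g :
  lift_mx b *m aG g = (-1) ^+ (b && odd_perm g) *: (set_mx K (ksets n k) g *m lift_mx b).
Proof.
rewrite regular_fmx !mul_fmx fmxZ; apply: eq_fmx => X z Xk _.
rewrite (bigD1 (z * g^-1)%g) ?inE //= mulgKV eqxx mulr1 big1 ?addr0; last first.
  by move=> y /andP[_ /negbTE ny]; case: (z =P _) => [zE|_]; rewrite ?mulr0 //; rewrite zE mulgK eqxx in ny.
rewrite (bigD1 (g @: X)) ?eqxx ?mul1r /=; last by move: Xk; rewrite !inE card_imset_perm.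
rewrite big1 ?addr0; last by move=> y /andP[_ /negbTE->]; rewrite mul0r.
rewrite mulrnAr -signr_addb -[in RHS](imset_permKV g (z @: B0)).
rewrite (inj_eq (can_inj (imset_permK g))) imset_permM odd_permM odd_permV.
by case: b => //=; rewrite addbC.
Qed.

Lemma polytabloid_lift b :
  polytabloid_mx K B0 f *m lift_mx b =
    fmx [set: 'S_n] [set: 'S_n] (fun x z : 'S_n => (-1) ^+ (b && odd_perm z) * ptab (x^-1%g @: (z @: B0))).
Proof.
rewrite mul_fmx; apply: eq_fmx => x z _ _.
rewrite (bigD1 (z @: B0)) ?inE ?card_imset_perm //= eqxx big1 ?addr0 1?mulrC //.
by move=> X /andP[_ /negbTE nX]; rewrite eq_sym nX mulr0.
Qed.

Lemma trace_on_lift b g :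
  trace_on (polytabloid_mx K B0 f *m lift_mx b) (aG g) = (-1) ^+ (b && odd_perm g) * fixed_diff g.
Proof.
rewrite (trace_on_inj (lift_mx_free b) _ (lift_mx_equivariant b g)).
  by rewrite trace_on_polytabloid.
exact: polytabloid_stable.
Qed.

Lemma sum_set_stab_mulr (F : 'S_n -> K) z c :
  \sum_(r in set_stab) F r *+ (z == r * c)%g = F (z * c^-1)%g *+ (z @: B0 == c @: B0).
Proof.
have -> : (z @: B0 == c @: B0) = ((z * c^-1)%g \in set_stab).
  by rewrite inE imset_permM -[RHS](inj_eq (can_inj (imset_permK c))) imset_permKV.
have eqz r : (z == r * c)%g = (r == z * c^-1)%g.
  by rewrite -(inj_eq (mulIg c^-1%g)) mulgK eq_sym.
have [Hz|Hz] := boolP ((z * c^-1)%g \in set_stab).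
  rewrite (bigD1 (z * c^-1)%g) //= mulgKV eqxx big1 ?addr0 // => r /andP[_ /negbTE nr].
  by rewrite eqz nr.
rewrite big1 // => r Hr; rewrite eqz; case: eqP => // eqr.
by rewrite -eqr Hr in Hz.
Qed.

Lemma sum_set_stab_mull (F : 'S_n -> K) u r :
  \sum_(h in set_stab) F h *+ (u == r * h)%g = F (r^-1 * u)%g *+ ((r^-1 * u)%g @: B0 == B0).
Proof.
have eqz h : (u == r * h)%g = (h == r^-1 * u)%g.
  by rewrite -(inj_eq (mulgI r^-1%g)) mulKg eq_sym.
have -> : ((r^-1 * u)%g @: B0 == B0) = ((r^-1 * u)%g \in set_stab) by rewrite inE.
have [Hu|Hu] := boolP ((r^-1 * u)%g \in set_stab).
  rewrite (bigD1 (r^-1 * u)%g) //= mulKVg eqxx big1 ?addr0 // => h /andP[_ /negbTE nh].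
  by rewrite eqz nh.
rewrite big1 // => h Hh; rewrite eqz; case: eqP => // eqh.
by rewrite -eqh Hh in Hu.
Qed.

(** Left multiplication by the symmetrizer first forms polytabloids and then lifts them
to the group ring, and the lift is injective. *)
Lemma trace_row_symmetrizer g :
  trace_on (cyclic_mx aG (\sum_(r in set_stab) \sum_(c in C)
     (-1) ^+ c *: gring_row (aG (r * c)%g))) (aG g) = fixed_diff g.
Proof.
rewrite gring_row_gvec; set phi := (fun z => _).
have phiE : left_mul_mx phi = polytabloid_mx K B0 f *m lift_mx false.
  rewrite polytabloid_lift; apply: eq_fmx => x z _ _; rewrite mul1r /phi exchange_big /=.
  apply: eq_bigr => c _; rewrite (sum_set_stab_mulr (fun=> (-1) ^+ c)).
  by rewrite imset_permM.
rewrite (eq_trace_on _ (cyclic_left_mul phi)).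
  by rewrite phiE trace_on_lift mul1r.
by have /mxmoduleP := cyclic_mx_module aG (gvec phi); apply; rewrite inE.
Qed.

(** Here the factor with signs is the large stabilizer.  In the transposed left
multiplication the two factors come in the opposite order, so that it forms polytabloids
and lifts them with signs; transposition also replaces g by its inverse, which fixes the
same subsets. *)
Lemma trace_column_symmetrizer g :
  trace_on (cyclic_mx aG (\sum_(r in C) \sum_(c in set_stab)
     (-1) ^+ c *: gring_row (aG (r * c)%g))) (aG g) = (-1) ^+ g * fixed_diff g.
Proof.
rewrite gring_row_gvec; set phi := (fun z => _).
rewrite (eq_trace_on _ (cyclic_left_mul phi)); last first.
  by have /mxmoduleP := cyclic_mx_module aG (gvec phi); apply; rewrite inE.
rewrite trace_on_tr ?left_mul_mxC // regular_tr.
(* D multiplies each basis vector by the sign of its permutation. *)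
pose D : 'M[K]_#|[set: 'S_n]| := fmx _ _ (fun x z => (-1) ^+ odd_perm x *+ (x == z)).
have DD : D *m D = 1%:M.
  rewrite mul_fmx -fmx_id; apply: eq_fmx => x z _ _.
  rewrite (bigD1 x) ?inE //= eqxx big1 ?addr0; last first.
    by move=> y /andP[_ /negbTE ny]; rewrite eq_sym ny mul0r.
  by case: eqP => _; rewrite ?mulr0 // -expr2 sqrr_sign.
have phiE : (left_mul_mx phi)^T = D *m (polytabloid_mx K B0 f *m lift_mx true).
  rewrite polytabloid_lift fmx_tr mul_fmx; apply: eq_fmx => x z _ _.
  rewrite [RHS](bigD1 x) ?inE //= eqxx big1 ?addr0; last first.
    by move=> y /andP[_ /negbTE ny]; rewrite eq_sym ny mul0r.
  rewrite /phi /polytabloid !mulr_sumr (reindex_inj invg_inj) /=.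
  apply: eq_big => [c|c _].
    apply/label_stabP/label_stabP=> fc i; last by rewrite -[in RHS](permKV c i) fc.
    by rewrite -[in RHS](permK c i) fc.
  rewrite (sum_set_stab_mull (fun c => (-1) ^+ odd_perm c)) invgK !odd_permM odd_permV.
  rewrite !imset_permM -[_ == B0](inj_eq (can_inj (imset_permK z))) imset_permKV.
  rewrite -[_ == z @: B0](inj_eq (can_inj (imset_permK x^-1%g))) imset_permK eq_sym.
  case: (_ == _); rewrite ?mulr0n ?mulr0 // !mulr1n.
  move: (odd_perm c) (odd_perm x) (odd_perm z) => bc bx bz.
  by rewrite !signr_addb mulrC -mulrA.
rewrite phiE.
have eqD : (polytabloid_mx K B0 f *m lift_mx true :=: D *m (polytabloid_mx K B0 f *m lift_mx true))%MS.
  by apply/eqmx_sym/eqmxMfull; rewrite row_full_unit; case/mulmx1_unit: DD.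
rewrite -(eq_trace_on _ eqD).
  by rewrite trace_on_lift odd_permV fixed_diffV.
rewrite -mulmxA lift_mx_equivariant -scalemxAr mulmxA scalemx_sub //.
by apply: submxMr; apply: polytabloid_stable.
Qed.
End TwoRowSymmetrizer.

(** * Specht characters of shapes with two rows or two columns *)

Section Parts.
Variable n : nat.
Implicit Types (la mu : intpart n).

Lemma parts_sorted la : sorted geq (parts la).
Proof. by case: la => t ok; case/andP: (ok). Qed.

Lemma parts_sum la : sumn (parts la) = n.
Proof. by case: la => t ok; case/andP: (ok) => _ /eqP. Qed.

Lemma parts_size la : size (parts la) = n.
Proof. by rewrite /parts size_map size_tuple. Qed.

Lemma parts_inj : injective (@parts n).
Proof. by move=> la mu /(inj_map val_inj) eqt; apply/val_inj/val_inj. Qed.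

Lemma leq_nth_sumn s i : (nth 0 s i <= sumn s)%N.
Proof.
elim: s i => [|x s IHs] [|i] //=; first exact: leq_addr.
exact: leq_trans (IHs i) (leq_addl _ _).
Qed.

Lemma intpart_ex s : sorted geq s -> sumn s = n -> size s = n ->
  exists la : intpart n, parts la = s.
Proof.
move=> sorted_s sum_s size_s.
have szt : size (map (@inord n) s) == n by rewrite size_map size_s.
have valt : map val (Tuple szt) = s.
  rewrite -map_comp -[RHS]map_id; apply/eq_in_map=> x /(nthP 0%N)[i _ <-].
  by rewrite /= inordK // ltnS -sum_s leq_nth_sumn.
have ok : sorted geq (map val (Tuple szt)) && (sumn (map val (Tuple szt)) == n).
  by rewrite valt sorted_s sum_s eqxx.
by exists (IntPart ok).
Qed.

Lemma sorted_geq_nth s i j : sorted geq s -> (i <= j)%N -> (nth 0 s j <= nth 0 s i)%N.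
Proof.
move=> sorted_s leij; have [ltj|lej] := ltnP j (size s); last by rewrite [nth _ _ j]nth_default.
apply: (sorted_leq_nth (leT:=geq)) => //; rewrite ?inE ?(leq_ltn_trans leij) //.
- by move=> a b c /= /[swap]; apply: leq_trans.
- by move=> a /=; exact: leqnn.
Qed.

Lemma lt_nth_count s i j : sorted geq s -> (j < nth 0 s i)%N = (i < count (ltn j) s)%N.
Proof.
elim: s i => [|x s IHs] i sorted_s; first by rewrite nth_nil.
have sorted_s' : sorted geq s by move: sorted_s => /=; apply: path_sorted.
have [ltjx|lexj] := ltnP j x.
  by rewrite /= ltjx; case: i => [|i] /=; rewrite ?ltjx ?IHs.
have -> : count (ltn j) (x :: s) = 0%N.
  apply/eqP; rewrite -leqn0 leqNgt -has_count; apply/hasP=> -[y /(nthP 0%N)[a _ <-]] /=.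
  have := sorted_geq_nth sorted_s (leq0n a) => /= le1.
  by rewrite ltnNge (leq_trans le1).
by rewrite ltn0 ltnNge (leq_trans _ lexj) // -[x]/(nth 0%N (x :: s) 0) sorted_geq_nth.
Qed.

(** Beyond the first part the list of conjugate parts stops, and so do the nonzero counts. *)
Lemma nth_conj_parts s j : sorted geq s -> nth 0 (conj_parts s) j = count (ltn j) s.
Proof.
move=> sorted_s; rewrite /conj_parts -nth0.
have [ltj|lej] := ltnP j (nth 0 s 0); first by rewrite nth_mkseq.
rewrite nth_default ?size_mkseq //; apply/eqP; rewrite eq_sym -leqn0 leqNgt.
by rewrite -(lt_nth_count _ _ sorted_s) -leqNgt.
Qed.

End Parts.

Section ShapeCharacters.
Variables (K : fieldType) (charK : [pchar K] =i pred0) (n : nat).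

Definition fixed_ksets (g : 'S_n) k : K := #|[set A : {set 'I_n} | (#|A| == k) && (g @: A == A)]|%:R.

(** The character of the shape (n-k, k), once 2k <= n. *)
Definition fixed_step g k : K := fixed_ksets g k - (if k is k'.+1 then fixed_ksets g k' else 0).

Lemma fixed_diffE (B0 : {set 'I_n}) g : fixed_diff K B0 g = fixed_step g #|B0|.
Proof.
rewrite /fixed_diff /fixed_step /fixed_ksets; congr (_%:R - _).
  by apply: eq_card => A; rewrite !inE.
case: #|B0| => [|k]; last by congr _%:R; apply: eq_card => A; rewrite !inE.
by rewrite (eq_card0 (A:=_)) // => A; rewrite !inE.
Qed.

Lemma stab_of_index (r : 'I_n -> nat) : (forall i, r i <= 1)%N ->
  [set s : 'S_n | [forall i, r (s i) == r i]] = set_stab [set i | r i == 1%N].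
Proof.
move=> r_le1; apply/setP=> s; rewrite !inE; apply/forallP/eqP=> [rs|sB i].
  apply/setP=> i; rewrite -[i](permKV s) mem_imset_perm !inE permKV.
  by have /eqP := rs (s^-1%g i); rewrite permKV => ->.
have : (s i \in s @: [set j | r j == 1%N]) = (r i == 1%N) by rewrite mem_imset_perm inE.
by rewrite sB inE; move: (r_le1 i) (r_le1 (s i)); case: (r i) (r (s i)) => [|[]] // [|[]].
Qed.

Section Shape.
Variable la : intpart n.
Let sh := parts la.
Let row (i : 'I_n) := reshape_index sh i.
Let off (i : 'I_n) := reshape_offset sh i.

Let lt_sum (i : 'I_n) : (i < sumn sh)%N. Proof. by rewrite parts_sum. Qed.

Let rowoff_inj i j : row i = row j -> off i = off j -> i = j.
Proof.
move=> eqr eqo; apply/val_inj; rewrite /= -(reshape_indexK sh i) -(reshape_indexK sh j).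
by rewrite -!/(row _) -!/(off _) eqr eqo.
Qed.

Let cell r c : (c < nth 0 sh r)%N -> exists2 i, row i = r & off i = c.
Proof.
move=> lt_c; have lt_n : (flatten_index sh r c < n)%N.
  by rewrite -(parts_sum la) flatten_indexP.
exists (Ordinal lt_n); [exact: flatten_indexKl | exact: flatten_indexKr].
Qed.

Let off_lt i : (off i < nth 0 sh (row i))%N. Proof. exact: reshape_offsetP. Qed.

Let mono r r' : (r <= r')%N -> (nth 0 sh r' <= nth 0 sh r)%N.
Proof. exact/sorted_geq_nth/parts_sorted. Qed.

Lemma specht_char_trace g :
  specht_char K la g = trace_on (cyclic_mx (regular_repr K [set: 'S_n]) (young_symmetrizer K la))
    (regular_repr K [set: 'S_n] g).
Proof. exact: trace_submod. Qed.

(** The labels are the columns, and the second row has nth 0 sh 1 cells. *)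
Lemma specht_char_two_row g :
  nth 0%N sh 2 = 0%N -> specht_char K la g = fixed_step g (nth 0%N sh 1).
Proof.
move=> sh2; rewrite specht_char_trace.
have row_le1 i : (row i <= 1)%N.
  have := off_lt i; apply: contraTT; rewrite -ltnNge => /mono.
  by rewrite sh2 leqn0 => /eqP->.
pose B0 := [set i | row i == 1%N].
have -> : nth 0%N sh 1 = #|B0|.
  pose h (c : 'I_(nth 0%N sh 1)) : 'I_n := s2val (cid2 (cell (ltn_ord c))).
  have hP c : row (h c) = 1%N /\ off (h c) = c by rewrite /h; case: cid2.
  have -> : B0 = h @: setT.
    apply/setP=> i; rewrite inE; apply/eqP/imsetP=> [ri|[c _ ->]]; last by case: (hP c).
    have ltc : (off i < nth 0%N sh 1)%N by rewrite -ri off_lt.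
    by exists (Ordinal ltc) => //; apply: rowoff_inj; case: (hP (Ordinal ltc)) => e1 e2; rewrite ?e1 ?e2.
  rewrite card_imset ?cardsT ?card_ord // => c c' eqh.
  by apply: val_inj; rewrite /= -(hP c).2 -(hP c').2 eqh.
rewrite -fixed_diffE.
rewrite -(@trace_row_symmetrizer K n B0 off charK).
- by rewrite /young_symmetrizer /row_stab stab_of_index.
- move=> i j; rewrite !inE => eqr; apply: rowoff_inj.
  by move: (row_le1 i) (row_le1 j) eqr; case: (row i) (row j) => [|[]] // [|[]].
- move=> i; rewrite inE => /eqP ri.
  have [|j rj oj] := @cell 0 (off i); first by rewrite (leq_trans (off_lt i)) // ri mono.
  by exists j => //; rewrite inE rj.
Qed.

(** The labels are the rows, and the cells of the second column correspond to the
rows with at least two cells. *)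
Lemma specht_char_two_column g :
  nth 0%N (conj_parts sh) 2 = 0%N ->
  specht_char K la g = (-1) ^+ g * fixed_step g (nth 0%N (conj_parts sh) 1).
Proof.
rewrite !nth_conj_parts ?parts_sorted // => sh2; rewrite specht_char_trace.
have off_le1 i : (off i <= 1)%N.
  rewrite leqNgt -[X in (_ < X)%N]/(off i); apply/negP=> lt_off.
  have := leq_trans lt_off (ltnW (off_lt i)); rewrite leq_eqVlt lt_nth_count ?parts_sorted // sh2 orbF.
  by move=> /eqP eq2; have := off_lt i; rewrite -eq2 ltnNge lt_off.
pose B0 := [set i | off i == 1%N].
have -> : count (ltn 1) sh = #|B0|.
  have ltB (r : 'I_(count (ltn 1) sh)) : (1 < nth 0 sh r)%N.
    by rewrite lt_nth_count ?parts_sorted.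
  pose h (r : 'I_(count (ltn 1) sh)) : 'I_n := s2val (cid2 (cell (ltB r))).
  have hP r : row (h r) = r /\ off (h r) = 1%N by rewrite /h; case: cid2.
  have -> : B0 = h @: setT.
    apply/setP=> i; rewrite inE; apply/eqP/imsetP=> [oi|[c _ ->]]; last by case: (hP c).
    have ltr : (row i < count (ltn 1) sh)%N.
      by rewrite -lt_nth_count ?parts_sorted // -oi off_lt.
    by exists (Ordinal ltr) => //; apply: rowoff_inj; case: (hP (Ordinal ltr)) => e1 e2; rewrite ?e1 ?e2.
  rewrite card_imset ?cardsT ?card_ord // => c c' eqh.
  by apply: val_inj; rewrite /= -(hP c).1 -(hP c').1 eqh.
rewrite -fixed_diffE -(@trace_column_symmetrizer K n B0 row charK).
- by rewrite /young_symmetrizer /col_stab stab_of_index.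
- move=> i j; rewrite !inE => eqo eqr; apply: rowoff_inj => //.
  by move: (off_le1 i) (off_le1 j) eqo; case: (off i) (off j) => [|[]] // [|[]].
- move=> i; rewrite inE => /eqP oi.
  have [|j rj oj] := @cell (row i) 0; first by rewrite (leq_ltn_trans _ (off_lt i)).
  by exists j => //; rewrite inE oj.
Qed.
End Shape.
End ShapeCharacters.

(** * Sums over partitions *)

Section PartitionSums.
Variables (K : fieldType) (charK : [pchar K] =i pred0) (n : nat).

Definition fixed_subsets (g : 'S_n) : nat := #|[set A : {set 'I_n} | g @: A == A]|.

Lemma imset_permC (g : 'S_n) (A : {set 'I_n}) : g @: (~: A) = ~: (g @: A).
Proof. by apply/setP=> i; rewrite -[i](permKV g) inE !mem_imset_perm inE. Qed.

Lemma fixed_ksetsC (g : 'S_n) k : (k <= n)%N -> fixed_ksets K g (n - k)%N = fixed_ksets K g k.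
Proof.
move=> lekn; rewrite /fixed_ksets -(card_preimset _ (@setC_inj _)); congr _%:R.
apply: eq_card => A; rewrite !inE imset_permC (inj_eq (@setC_inj _)).
have := cardsC A; rewrite card_ord; set a := #|A|; set b := #|~: A|.
by move=> ab; congr (_ && _); apply/eqP/eqP; lia.
Qed.

Lemma sum_fixed_ksets g : \sum_(j < n.+1) fixed_ksets K g j = (fixed_subsets g)%:R.
Proof.
rewrite -natr_sum; congr _%:R; rewrite /fixed_subsets -sum1_card.
rewrite (partition_big (fun A : {set 'I_n} => inord #|A| : 'I_n.+1) xpredT) //=.
apply: eq_bigr => j _; rewrite -sum1_card; apply: eq_bigl => A.
rewrite !inE andbC; congr (_ && _); rewrite -val_eqE /= inordK //.
by rewrite ltnS -[X in (_ <= X)%N](card_ord n) max_card.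
Qed.

Lemma sum_fixed_step (g : 'S_n) m : \sum_(k < m.+1) fixed_step K g k = fixed_ksets K g m.
Proof.
elim: m => [|m IHm]; first by rewrite big_ord1 /fixed_step subr0.
by rewrite big_ord_recr IHm /fixed_step /= addrC subrK.
Qed.

(** Replace each weight by a sum over the j with k <= j <= n - k and exchange the two sums:
for fixed j the differences with k <= min(j, n-j) telescope to the number of stable
subsets of size min(j, n-j), which is also their number for the size j. *)
Lemma sum_fixed_step_weighted (g : 'S_n) :
  \sum_(k < n./2.+1) ((n - k - k + 1)%N)%:R * fixed_step K g k = (fixed_subsets g)%:R.
Proof.
transitivity (\sum_(k < n./2.+1) \sum_(j < n.+1 | (k <= j <= n - k)%N) fixed_step K g k).
  apply: eq_bigr => k _.
  have le2 : (k <= n - k)%N by have := ltn_ord k; lia.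
  transitivity (\sum_(k <= j < (n - k).+1) fixed_step K g k).
    by rewrite sumr_const_nat mulr_natl; congr (_ *+ _); lia.
  rewrite (@big_nat_widen _ _ _ _ _ n.+1); last by rewrite ltnS leq_subr.
  by rewrite big_geq_mkord; apply: eq_bigl => j /=; rewrite andbC ltnS.
rewrite (exchange_big_dep xpredT) //= -sum_fixed_ksets; apply: eq_bigr => j _.
have lejn : (j <= n)%N by rewrite -ltnS.
pose i := minn j (n - j).
transitivity (\sum_(k < i.+1) fixed_step K g k).
  rewrite (big_ord_widen n./2.+1 (fun k => fixed_step K g k)); last by rewrite /i; lia.
  by apply: eq_bigl => k; rewrite /i; lia.
rewrite sum_fixed_step /i /minn; case: ifP => // _; exact: fixed_ksetsC.
Qed.

Section Reindex.
Variables (P : pred (intpart n)) (key : intpart n -> nat).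
Hypothesis key_le : forall la, P la -> (2 * key la <= n)%N.
Hypothesis key_inj : forall la mu, P la -> P mu -> key la = key mu -> la = mu.
Hypothesis key_surj : forall k, (2 * k <= n)%N -> exists2 la, P la & key la = k.

(** The shapes in question correspond bijectively to the values 0 <= k <= n/2 of key. *)
Lemma sum_by_key (G : nat -> K) : \sum_(la | P la) G (key la) = \sum_(k < n./2.+1) G k.
Proof.
rewrite (partition_big (fun la => inord (key la) : 'I_n./2.+1) xpredT) //=.
apply: eq_bigr => k _; have [|la Pla keyla] := @key_surj k; first by have := ltn_ord k; lia.
rewrite (big_pred1 la) ?keyla // => mu; rewrite /= -val_eqE /=.
apply/andP/eqP=> [[Pmu]|->].
  rewrite inordK; last by have := key_le Pmu; lia.
  by move/eqP=> eqk; apply: key_inj; rewrite ?eqk.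
by rewrite Pla keyla inordK.
Qed.
End Reindex.

Lemma sum_ltn_ord m k : (k <= m)%N -> (\sum_(i < m) (i < k)%N = k)%N.
Proof.
move=> lekm; rewrite -[RHS]card_ord -sum1_card (big_ord_widen m (fun=> 1%N)) //.
by rewrite [RHS]big_mkcond; apply: eq_bigr => i _; case: ltnP.
Qed.

Definition two_row (la : intpart n) := nth 0%N (parts la) 2 == 0%N.
Definition two_col (mu : intpart n) := nth 0%N (conj_parts (parts mu)) 2 == 0%N.

Lemma nth_ge2 s i : sorted geq s -> nth 0%N s 2 = 0%N -> nth 0%N s i.+2 = 0%N.
Proof.
move=> sorted_s s2; have := sorted_geq_nth sorted_s (isT : 2 <= i.+2)%N.
by rewrite s2 leqn0 => /eqP.
Qed.

Lemma two_row_sum la : two_row la -> (nth 0 (parts la) 0 + nth 0 (parts la) 1 = n)%N.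
Proof.
move=> /eqP r2; rewrite -{3}(parts_sum la).
have z i : nth 0%N (parts la) i.+2 = 0%N by exact: nth_ge2 (parts_sorted la) r2.
case: (parts la) z => [|a [|b s]] //= z.
suff -> : sumn s = 0%N by rewrite addn0.
rewrite sumnE big1_seq // => x /andP[_ /(nthP 0%N)[i _ <-]].
exact: (z i).
Qed.

Lemma sum_two_row (G : nat -> K) :
  \sum_(la | two_row la) G (nth 0%N (parts la) 1) = \sum_(k < n./2.+1) G k.
Proof.
apply: (@sum_by_key two_row (fun la => nth 0%N (parts la) 1)).
- move=> la /two_row_sum eqn.
  by have := sorted_geq_nth (parts_sorted la) (leq0n 1); lia.
- move=> la mu Pla Pmu eq1; apply: parts_inj.
  apply: (@eq_from_nth _ 0%N); rewrite ?parts_size // => -[|[|i]] _ //.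
    by have := two_row_sum Pla; have := two_row_sum Pmu; lia.
  by rewrite (nth_ge2 _ (parts_sorted la) (eqP Pla)) (nth_ge2 _ (parts_sorted mu) (eqP Pmu)).
move=> k le2k; pose s := mkseq (nth 0%N [:: n - k; k]%N) n.
have nths i : nth 0%N s i = nth 0%N [:: n - k; k]%N i.
  have [lt|le] := ltnP i n; first by rewrite nth_mkseq.
  rewrite nth_default ?size_mkseq //.
  case: i le => [|[|i]] /=; [lia|lia|by rewrite nth_nil].
have [||| la eqla] := @intpart_ex n s.
- apply/(sortedP 0%N) => i _; rewrite !nths; case: i => [|[|i]] /=; rewrite ?nth_nil //; lia.
- rewrite sumnE big_map -[n in iota _ n]subn0 -/(index_iota 0 n) big_mkord.
  have := le2k; case: (n) => [|[|m]] le2.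
  + by rewrite big_ord0.
  + by rewrite big_ord1 /=; lia.
  + rewrite 2!big_ord_recl /= big1 ?addn0; first by lia.
    by move=> i _; rewrite nth_nil.
- by rewrite size_mkseq.
by exists la; rewrite ?/two_row eqla nths.
Qed.

Lemma two_col_sum mu : two_col mu ->
  (count (ltn 0) (parts mu) + count (ltn 1) (parts mu) = n)%N.
Proof.
rewrite /two_col nth_conj_parts ?parts_sorted // => /eqP c2; rewrite -{3}(parts_sum mu).
elim: (parts mu) c2 => //= x s IHs.
case: x => [|[|[|x]]] //= /IHs; lia.
Qed.

Lemma sum_two_col (G : nat -> K) :
  \sum_(mu | two_col mu) G (nth 0%N (conj_parts (parts mu)) 1) = \sum_(k < n./2.+1) G k.
Proof.
have conjE mu j : nth 0%N (conj_parts (parts mu)) j = count (ltn j) (parts mu).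
  by rewrite nth_conj_parts ?parts_sorted.
have count_anti s i j : (i <= j)%N -> (count (ltn j) s <= count (ltn i) s)%N.
  by move=> leij; apply: sub_count => x /=; apply: leq_ltn_trans.
have zero mu j : two_col mu -> count (ltn j.+2) (parts mu) = 0%N.
  rewrite /two_col conjE => /eqP c2; have := count_anti (parts mu) 2 j.+2 isT.
  by rewrite c2 leqn0 => /eqP.
apply: (@sum_by_key two_col (fun la => nth 0%N (conj_parts (parts la)) 1)).
- by move=> mu /two_col_sum; have := count_anti (parts mu) 0%N 1%N isT; rewrite conjE; lia.
- move=> la mu Pla Pmu; rewrite !conjE => eq1; apply: parts_inj.
  apply: (@eq_from_nth _ 0%N); rewrite ?parts_size // => i _.
  have H j : (j < nth 0 (parts la) i)%N = (j < nth 0 (parts mu) i)%N.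
    rewrite !lt_nth_count ?parts_sorted //; congr (_ < _)%N.
    case: j => [|[|j]] //; last by rewrite !zero.
    by have := two_col_sum Pla; have := two_col_sum Pmu; lia.
  by apply/eqP; rewrite eqn_leq leqNgt H ltnn leqNgt -H ltnn.
move=> k le2k; pose s := mkseq (fun i => (i < n - k) + (i < k))%N n.
have nths i : nth 0%N s i = ((i < n - k) + (i < k))%N.
  have [lt|le] := ltnP i n; first by rewrite nth_mkseq.
  by rewrite nth_default ?size_mkseq //; lia.
have counts j : count (ltn j) s = (\sum_(i < n) (j < (i < n - k) + (i < k)))%N.
  rewrite -sum1_count big_mkcond big_map -[n in iota _ n]subn0 -/(index_iota 0 n) big_mkord.
  by apply: eq_bigr => i _; case: ltnP.
have [||| la eqla] := @intpart_ex n s.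
- by apply/(sortedP 0%N) => i _; rewrite !nths /=; lia.
- rewrite sumnE big_map -[n in iota _ n]subn0 -/(index_iota 0 n) big_mkord big_split /=.
  by rewrite !sum_ltn_ord; lia.
- by rewrite size_mkseq.
exists la; rewrite ?/two_col conjE eqla counts.
  by rewrite big1 // => i _; lia.
rewrite -[RHS](@sum_ltn_ord n k); last by lia.
by apply: eq_bigr => i _; congr nat_of_bool; lia.
Qed.

Lemma two_row_characters g :
  \sum_(la | two_row la)
    ((nth 0 (parts la) 0 - nth 0 (parts la) 1 + 1)%N)%:R * specht_char K la g
  = (fixed_subsets g)%:R.
Proof.
rewrite -sum_fixed_step_weighted -(sum_two_row (fun k => ((n - k - k + 1)%N)%:R * fixed_step K g k)).
apply: eq_bigr => la Pla; rewrite specht_char_two_row //; last exact/eqP.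
by congr ((_ - _ + _)%N%:R * _); have := two_row_sum Pla; lia.
Qed.

Lemma two_column_characters g :
  \sum_(mu | two_col mu) ((nth 0 (conj_parts (parts mu)) 0
     - nth 0 (conj_parts (parts mu)) 1 + 1)%N)%:R * specht_char K mu g
  = (-1) ^+ g * (fixed_subsets g)%:R.
Proof.
rewrite -sum_fixed_step_weighted mulr_sumr.
rewrite -(sum_two_col (fun k => (-1) ^+ g * (((n - k - k + 1)%N)%:R * fixed_step K g k))).
apply: eq_bigr => mu Pmu; rewrite specht_char_two_column //; last exact/eqP.
rewrite mulrCA; congr (_ * ((_ - _ + _)%N%:R * _)).
by have := two_col_sum Pmu; rewrite !nth_conj_parts ?parts_sorted //; lia.
Qed.

Lemma fixed_step0 (g : 'S_n) : fixed_step K g 0 = 1.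
Proof.
rewrite /fixed_step subr0 /fixed_ksets (_ : [set _ | _] = [set set0]) ?cards1 //.
apply/setP=> A; rewrite !inE cards_eq0; case: eqP => // ->.
by rewrite imset0 eqxx.
Qed.

Lemma one_row_character g :
  \sum_(la : intpart n | nth 0%N (parts la) 1 == 0%N) specht_char K la g = 1.
Proof.
have imp (la : intpart n) : nth 0%N (parts la) 1 == 0%N -> two_row la.
  move=> /eqP r1; have := sorted_geq_nth (parts_sorted la) (isT : 1 <= 2)%N.
  by rewrite r1 leqn0.
rewrite -[RHS](fixed_step0 g).
transitivity (\sum_(la | two_row la) (if nth 0%N (parts la) 1 == 0%N then
   fixed_step K g (nth 0%N (parts la) 1) else 0)).
  rewrite -big_mkcondr; apply: eq_big => [la|la r1].
    by rewrite andb_idl //; apply: imp.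
  by rewrite specht_char_two_row //; apply/eqP/imp.
rewrite (sum_two_row (fun k => if k == 0%N then fixed_step K g k else 0)).
by rewrite big_ord_recl /= big1 ?addr0.
Qed.

Lemma one_column_character g :
  \sum_(mu : intpart n | nth 0%N (conj_parts (parts mu)) 1 == 0%N) specht_char K mu g
  = (-1) ^+ g.
Proof.
have imp (mu : intpart n) : nth 0%N (conj_parts (parts mu)) 1 == 0%N -> two_col mu.
  rewrite /two_col !nth_conj_parts ?parts_sorted // -!leqn0; apply: leq_trans.
  by apply: sub_count => x /=; apply: ltnW.
rewrite -[RHS]mulr1 -[X in _ * X](fixed_step0 g).
transitivity (\sum_(mu | two_col mu) (if nth 0%N (conj_parts (parts mu)) 1 == 0%N then
   (-1) ^+ g * fixed_step K g (nth 0%N (conj_parts (parts mu)) 1) else 0)).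
  rewrite -big_mkcondr; apply: eq_big => [mu|mu r1].
    by rewrite andb_idl //; apply: imp.
  by rewrite specht_char_two_column //; apply/eqP/imp.
rewrite (sum_two_col (fun k => if k == 0%N then (-1) ^+ g * fixed_step K g k else 0)).
by rewrite big_ord_recl /= big1 ?addr0.
Qed.
End PartitionSums.

(** The last product is the multiplicity except for the shapes with la_2 = mu'_2 = 0, where
constant colourings are lost: two of them in general, but one in degree 1. *)
Lemma multiplicityE p q (la : intpart p) (mu : intpart q) : (0 < p + q)%N ->
  (multiplicity (parts la) (parts mu) +
    (if p + q == 1 then 1 else 2) * ((nth 0 (parts la) 1 == 0) && (nth 0 (conj_parts (parts mu)) 1 == 0))
  = (two_row la && two_col mu) *
    ((nth 0 (parts la) 0 - nth 0 (parts la) 1 + 1) *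
     (nth 0 (conj_parts (parts mu)) 0 - nth 0 (conj_parts (parts mu)) 1 + 1)))%N.
Proof.
move=> pq_gt0; rewrite /multiplicity !parts_sum /two_row /two_col.
have := two_row_sum (la := la); have := two_col_sum (mu := mu).
rewrite /two_row /two_col !nth_conj_parts ?parts_sorted //.
have := sorted_geq_nth (parts_sorted la) (isT : 0 <= 1)%N.
have := sorted_geq_nth (parts_sorted la) (isT : 1 <= 2)%N.
have : (count (ltn 1) (parts mu) <= count (ltn 0) (parts mu))%N.
  by apply: sub_count => x /=; apply: ltnW.
have : (count (ltn 2) (parts mu) <= count (ltn 1) (parts mu))%N.
  by apply: sub_count => x /=; apply: ltnW.
have : (nth 0 (parts la) 0 + nth 0 (parts la) 1 <= p)%N.
  by rewrite -[X in (_ <= X)%N](parts_sum la); case: (parts la) => [|a [|b l]] //=; rewrite addnA leq_addr.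
have : (count (ltn 0) (parts mu) + count (ltn 1) (parts mu) <= q)%N.
  rewrite -[X in (_ <= X)%N](parts_sum mu); elim: (parts mu) => //= x l.
  by case: x => [|[|x]] /=; lia.
move: (nth 0%N _ 0) (nth 0%N _ 1) (nth 0%N _ 2) (count (ltn 0) _) (count (ltn 1) _) (count (ltn 2) _).
move=> r0 r1 r2 c0 c1 c2 le_q le_p le21 le10 ler21 ler10.
case: (r2 =P 0%N) => [_|r2n]; case: (c2 =P 0%N) => [_|c2n] /= Hc Hr.
- rewrite mul1n; have {Hc Hr}[Hc Hr] := (Hc isT, Hr isT).
  rewrite addn_gt0 !lt0n; case: (r1 =P 0%N) => [r10|_]; case: (c1 =P 0%N) => [c10|_] /=;
    rewrite ?muln0 ?muln1 ?addn0 //.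
  rewrite r10 c10 !subn0 in Hr Hc *; rewrite !addn0 in Hr Hc.
  rewrite Hr Hc; case: ((p + q)%N =P 1%N) => [eq1|ne1].
    by rewrite eq1 /=; case: (p) (q) eq1 => [|[|?]] [|[|?]].
  by rewrite (_ : (2 <= p + q)%N) /=; nia.
- case: (c1 =P 0%N) => [c10|c1n]; first by move: le21; rewrite c10 leqn0 => /eqP.
  by rewrite !andbF /= (_ : (p + q == 1)%N = false) ?andbF //; lia.
- case: (r1 =P 0%N) => [r10|r1n]; first by move: ler21; rewrite r10 leqn0 => /eqP.
  by rewrite !andbF /= (_ : (p + q == 1)%N = false) ?andbF //; lia.
- case: (r1 =P 0%N) => [r10|r1n]; first by move: ler21; rewrite r10 leqn0 => /eqP.
  by rewrite !andbF /= (_ : (p + q == 1)%N = false) ?andbF //; lia.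
Qed.

Lemma cocharacter_formula (K : fieldType) (charK : [pchar K] =i pred0) p q
    (pq_gt0 : (0 < p + q)%N) (g : 'S_p * 'S_q) :
  \sum_(la : intpart p) \sum_(mu : intpart q)
     (multiplicity (parts la) (parts mu))%:R * (specht_char K la g.1 * specht_char K mu g.2)
  = (-1) ^+ g.2 * ((fixed_subsets g.1 * fixed_subsets g.2)%:R
      - (if (p + q == 1)%N then 1 else 2)%N%:R).
Proof.
case: g => s t /=; set e := (if _ then _ else _).
have split_mult (la : intpart p) (mu : intpart q) :
    (multiplicity (parts la) (parts mu))%:R * (specht_char K la s * specht_char K mu t) =
    (if two_row la then (nth 0 (parts la) 0 - nth 0 (parts la) 1 + 1)%N%:R * specht_char K la s else 0) *
    (if two_col mu then (nth 0 (conj_parts (parts mu)) 0 - nth 0 (conj_parts (parts mu)) 1 + 1)%N%:R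
       * specht_char K mu t else 0)
    - e%:R * ((if nth 0%N (parts la) 1 == 0%N then specht_char K la s else 0) *
       (if nth 0%N (conj_parts (parts mu)) 1 == 0%N then specht_char K mu t else 0)).
  have /(congr1 (fun m => m%:R : K)) := multiplicityE la mu pq_gt0.
  rewrite -/e natrD => /(canRL (addrK _)) ->; rewrite mulrBl; congr (_ - _).
    by case: two_row; case: two_col; rewrite /= ?mul0n ?mul0r ?mulr0 // mul1n natrM mulrACA.
  rewrite natrM -mulrA; congr (_ * _).
  by case: (nth _ _ _ == _); case: (nth _ _ _ == _); rewrite /= ?mul0r ?mulr0 ?mul1r.
under eq_bigr do under eq_bigr do rewrite split_mult.
under eq_bigr do rewrite sumrB; rewrite sumrB -big_distrlr /= -!big_mkcond.
rewrite two_row_characters // two_column_characters //.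
under [X in _ - X]eq_bigr do rewrite -mulr_sumr; rewrite -mulr_sumr -big_distrlr /= -!big_mkcond.
rewrite one_row_character // one_column_character //.
by rewrite natrM mul1r mulrBr mulrCA [e%:R * _]mulrC.
Qed.

(** * Monomials as tagged words *)

Notation letter := (gen * bool)%type.

(** A leaf is tagged with true when it is a left factor and with false when it is a right
factor; b is the tag of a tree that is a single leaf. *)
Fixpoint word (b : bool) (t : monomial) : seq letter :=
  match t with
  | Gen x => [:: (x, b)]
  | Mul u v => word true u ++ word false v
  end.

Lemma map_fst_word b t : map fst (word b t) = leaves t.
Proof. by elim: t b => //= u IHu v IHv _; rewrite map_cat IHu IHv. Qed.

Definition odd_letter (a : letter) : bool := if a.1 is inr _ then true else false.

Definition word_parity (w : seq letter) : bool := odd (count odd_letter w).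

Lemma parity_word b t : parity t = word_parity (word b t).
Proof.
elim: t b => [[]|u IHu v IHv] b //=.
by rewrite /word_parity count_cat oddD -!/(word_parity _) -IHu -IHv.
Qed.

(** A function of tagged words in which exchanging two neighbours costs the sign of the
superalgebra. *)
Section Alternating.
Variables (K : fieldType) (omega : seq letter -> K).
Hypothesis omega_swap : forall w1 a b w2, omega (w1 ++ a :: b :: w2) =
  (-1) ^+ (odd_letter a && odd_letter b) * omega (w1 ++ b :: a :: w2).

Lemma omega_move w1 a v w2 : omega (w1 ++ a :: v ++ w2) =
  (-1) ^+ (odd_letter a && word_parity v) * omega (w1 ++ v ++ a :: w2).
Proof.
elim: v w1 => [|b v IHv] w1 /=; first by rewrite andbF mul1r.
rewrite omega_swap -cat_rcons IHv cat_rcons mulrA -signr_addb; congr (_ ^+ _ * _).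
by rewrite /word_parity /= oddD oddb -andb_addr.
Qed.

Lemma omega_block w1 u v w2 : omega (w1 ++ u ++ v ++ w2) =
  (-1) ^+ (word_parity u && word_parity v) * omega (w1 ++ v ++ u ++ w2).
Proof.
elim: u w1 => [|a u IHu] w1 /=; first by rewrite mul1r.
rewrite -cat_rcons IHu cat_rcons omega_move mulrA -signr_addb; congr (_ ^+ _ * _).
by rewrite /word_parity /= oddD oddb -andb_addl addbC.
Qed.

Notation omega_ext b w1 w2 := (linext (fun t => omega (w1 ++ word b t ++ w2) : K^o)).

Lemma linext_amull (phi : monomial -> K^o) f g :
  linext phi (amul f g) =
    \sum_(u <- msupp f) f@_u *: linext (fun v => phi (Mul u v)) g.
Proof.
rewrite amul.unlock (linear_linext (linext phi)); apply: eq_bigr => u _.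
congr (_ *: _); rewrite (linear_linext (linext phi)).
by apply: eq_linext => v; apply: linextU.
Qed.

Lemma linext_amulr (phi : monomial -> K^o) f g :
  linext phi (amul f g) =
    \sum_(v <- msupp g) g@_v *: linext (fun u => phi (Mul u v)) f.
Proof.
rewrite linext_amull /linext; under eq_bigr do rewrite scaler_sumr.
rewrite exchange_big; apply: eq_bigr => v _; rewrite scaler_sumr.
by apply: eq_bigr => u _; rewrite !scalerA mulrC.
Qed.

Lemma linext_amul_left (phi : monomial -> K^o) f g h :
  linext phi (amul f (amul g h)) =
    \sum_(u <- msupp f) \sum_(v <- msupp g) \sum_(w <- msupp h)
      (f@_u * g@_v * h@_w) * phi (Mul u (Mul v w)).
Proof.
rewrite linext_amull; apply: eq_bigr => u _.
rewrite linext_amull scaler_sumr; apply: eq_bigr => v _.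
by rewrite /linext !scaler_sumr; apply: eq_bigr => w _; rewrite !scalerA.
Qed.

Lemma linext_amul_right (phi : monomial -> K^o) f g h :
  linext phi (amul (amul f g) h) =
    \sum_(u <- msupp f) \sum_(v <- msupp g) \sum_(w <- msupp h)
      (f@_u * g@_v * h@_w) * phi (Mul (Mul u v) w).
Proof.
rewrite linext_amulr.
transitivity (\sum_(w <- msupp h) \sum_(u <- msupp f) \sum_(v <- msupp g)
      (f@_u * g@_v * h@_w) * phi (Mul (Mul u v) w)).
  apply: eq_bigr => w _; rewrite linext_amull scaler_sumr; apply: eq_bigr => u _.
  rewrite /linext !scaler_sumr; apply: eq_bigr => v _; rewrite !scalerA.
  by rewrite [_ * h@_w]mulrC mulrA.
by rewrite exchange_big; apply: eq_bigr => u _; rewrite exchange_big.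
Qed.

(** The identities exchange two neighbouring blocks of the word.  The context (w1, w2) makes
the induction pass through products: a factor on the other side only extends the
context. *)
Lemma omega_ideal f b w1 w2 : bicomm_ideal f -> omega_ext b w1 w2 f = 0.
Proof.
move=> If; elim: If b w1 w2 => {f} [i j k f g h fi gj hk|i j k f g h fi gj hk|
  |f g _ IHf _ IHg|c f _ IHf|f g _ IHg|f g _ IHf] b w1 w2.
- rewrite linearB linearZ /= !linext_amul_left; apply/eqP; rewrite subr_eq0; apply/eqP.
  rewrite exchange_big scaler_sumr; apply: eq_big_seq => v gv.
  rewrite scaler_sumr; apply: eq_big_seq => u fu.
  rewrite scaler_sumr; apply: eq_bigr => w _; rewrite /= -!catA omega_block -!parity_word.
  by rewrite (fi u fu) (gj v gv) /GRing.scale /= mulrCA [g@_v * _]mulrC.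
- rewrite linearB linearZ /= !linext_amul_right; apply/eqP; rewrite subr_eq0; apply/eqP.
  rewrite scaler_sumr; apply: eq_big_seq => u fu.
  rewrite [in RHS]exchange_big scaler_sumr; apply: eq_big_seq => v gv.
  rewrite scaler_sumr; apply: eq_big_seq => w hw; rewrite /= -!catA.
  rewrite (catA w1) omega_block -!parity_word -!catA.
  by rewrite (hk w hw) (gj v gv) /GRing.scale /= mulrCA [_ * h@_w * _]mulrAC.
- by rewrite linear0.
- by rewrite linearD /= IHf IHg addr0.
- by rewrite linearZ /= IHf scaler0.
- rewrite linext_amull big1 // => u _.
  transitivity (f@_u *: omega_ext false (w1 ++ word true u) w2 g); last by rewrite IHg scaler0.
  by congr (_ *: _); apply: eq_linext => v; rewrite /= -!catA.
- rewrite linext_amulr big1 // => v _ /=.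
  transitivity (g@_v *: omega_ext true w1 (word false v ++ w2) f); last by rewrite IHf scaler0.
  by congr (_ *: _); apply: eq_linext => u; rewrite /= -!catA.
Qed.
End Alternating.

Section Similarity.
Variable K : fieldType.
Notation mon t := (toF (<< t >> : {malg K[monomial]})).

(** The sign is left open, because it can be recovered from the words by a function that
is alternating. *)
Definition sim t t' := (forall b, perm_eq (word b t) (word b t')) /\
  exists s : bool, mon t = (-1) ^+ s *: mon t'.

Lemma sim_refl t : sim t t.
Proof. by split=> [b //|]; exists false; rewrite scale1r. Qed.

Lemma sim_sym t t' : sim t t' -> sim t' t.
Proof.
case=> wt [s eqt]; split=> [b|]; first by rewrite perm_sym.
by exists s; rewrite eqt scalerA -signr_addb addbb scale1r.
Qed.

Lemma sim_trans t' t t'' : sim t t' -> sim t' t'' -> sim t t''.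
Proof.
case=> wt [s eqt] [wt' [s' eqt']]; split=> [b|]; first exact: perm_trans (wt b) (wt' b).
by exists (s (+) s'); rewrite eqt eqt' scalerA -signr_addb.
Qed.

Lemma monM u v : mon (Mul u v) = Fmul (mon u) (mon v).
Proof. by rewrite -toFM amulUU. Qed.

Lemma sim_mulr u t t' : sim t t' -> sim (Mul u t) (Mul u t').
Proof.
case=> wt [s eqt]; split=> [b|] /=; first by rewrite perm_cat2l.
by exists s; rewrite !monM eqt -[_ *: mon t']toFZ -toFM amulZr toFZ toFM.
Qed.

Lemma sim_mull u t t' : sim t t' -> sim (Mul t u) (Mul t' u).
Proof.
case=> wt [s eqt]; split=> [b|] /=; first by rewrite perm_cat2r.
by exists s; rewrite !monM eqt -[_ *: mon t']toFZ -toFM amulZl toFZ toFM.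
Qed.

Lemma mon_homogeneous u : Fhomogeneous (parity u) (mon u).
Proof.
exists << u >> => // v; rewrite msuppU oner_eq0 inE => /eqP->.
by [].
Qed.

Lemma sim_left u v w : sim (Mul u (Mul v w)) (Mul v (Mul u w)).
Proof.
split=> [b|] /=; first by rewrite perm_catCA.
exists (parity u && parity v); rewrite !monM.
exact: Fmul_left (mon_homogeneous u) (mon_homogeneous v) (mon_homogeneous w).
Qed.

Lemma sim_right u v w : sim (Mul (Mul u v) w) (Mul (Mul u w) v).
Proof.
split=> [b|] /=; first by rewrite perm_catAC.
exists (parity v && parity w); rewrite !monM.
exact: Fmul_right (mon_homogeneous u) (mon_homogeneous v) (mon_homogeneous w).
Qed.

(** Both sides reduce to (u c)(a b) by moving factors of the same side past each other. *)
Lemma sim_assoc u a b c : sim (Mul u (Mul (Mul a b) c)) (Mul (Mul u (Mul a b)) c).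
Proof.
(* u((ab)c), (ab)(uc), (a(uc))b, (u(ac))b, (ub)(ac), a((ub)c), a((uc)b), (uc)(ab), (u(ab))c *)
apply: sim_trans (sim_left _ _ _) _; apply: sim_trans (sim_right _ _ _) _.
apply: sim_trans (sim_mull _ (sim_left _ _ _)) _; apply: sim_trans (sim_right _ _ _) _.
apply: sim_trans (sim_left _ _ _) _; apply: sim_trans (sim_mulr _ (sim_right _ _ _)) _.
apply: sim_trans (sim_left _ _ _) _; exact: sim_right.
Qed.

Definition lmuls (ls : seq gen) t := foldr (fun x => Mul (Gen x)) t ls.
Definition rmuls t (rs : seq gen) := foldl (fun t y => Mul t (Gen y)) t rs.

(** The innermost product l r is kept apart, so that both a left and a right factor are
always present. *)
Definition nf ls l r rs := lmuls ls (rmuls (Mul (Gen l) (Gen r)) rs).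

Lemma sim_lmuls ls t t' : sim t t' -> sim (lmuls ls t) (lmuls ls t').
Proof. by move=> tt'; elim: ls => //= x ls; apply: sim_mulr. Qed.

Lemma sim_rmuls rs t t' : sim t t' -> sim (rmuls t rs) (rmuls t' rs).
Proof. by elim: rs t t' => //= y rs IHrs t t' tt'; apply/IHrs/sim_mull. Qed.

Lemma rmuls_rcons t rs y : rmuls t (rcons rs y) = Mul (rmuls t rs) (Gen y).
Proof. by rewrite /rmuls foldl_rcons. Qed.

Lemma rmuls_mul a b rs : exists a' b', rmuls (Mul a b) rs = Mul a' b'.
Proof. by elim: rs a b => [|y rs IHrs] a b /=; [exists a, b | apply: IHrs]. Qed.

Lemma lmuls_mul a b ls : exists a' b', lmuls ls (Mul a b) = Mul a' b'.
Proof. by case: ls => [|x ls] /=; eexists; eexists. Qed.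

Lemma nf_mul ls l r rs : exists a b, nf ls l r rs = Mul a b.
Proof.
by rewrite /nf; have [a [b ->]] := rmuls_mul (Gen l) (Gen r) rs; apply: lmuls_mul.
Qed.

Lemma lmuls_mulr ls a b t : sim (Mul (lmuls ls (Mul a b)) t) (lmuls ls (Mul (Mul a b) t)).
Proof.
elim: ls => [|x ls IHls] /=; first exact: sim_refl.
apply: sim_trans (sim_mulr _ IHls); apply: sim_sym.
have [a' [b' ->]] := lmuls_mul a b ls; exact: sim_assoc.
Qed.

Lemma mul_lmuls u ls t : sim (Mul u (lmuls ls t)) (lmuls ls (Mul u t)).
Proof.
elim: ls => [|x ls IHls] /=; first exact: sim_refl.
exact: sim_trans (sim_left _ _ _) (sim_mulr _ IHls).
Qed.

Lemma mul_rmuls u a b rs : sim (Mul u (rmuls (Mul a b) rs)) (rmuls (Mul u (Mul a b)) rs).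
Proof.
elim/last_ind: rs => [|rs y IHrs]; first exact: sim_refl.
rewrite !rmuls_rcons; apply: sim_trans (sim_mull _ IHrs).
have [a' [b' ->]] := rmuls_mul a b rs; exact: sim_assoc.
Qed.

Definition has_nf t := exists ls l r rs, sim t (nf ls l r rs).

Lemma has_nf_sim t t' : sim t t' -> has_nf t' -> has_nf t.
Proof. by move=> tt' [ls [l [r [rs snf]]]]; exists ls, l, r, rs; apply: sim_trans snf. Qed.

Lemma has_nf_mulr t y : has_nf t -> has_nf (Mul t (Gen y)).
Proof.
case=> ls [l [r [rs snf]]]; exists ls, l, r, (rcons rs y).
apply: sim_trans (sim_mull _ snf) _; rewrite /nf rmuls_rcons.
have [a [b ->]] := rmuls_mul (Gen l) (Gen r) rs; exact: lmuls_mulr.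
Qed.

Lemma has_nf_mull t x : has_nf t -> has_nf (Mul (Gen x) t).
Proof. by case=> ls [l [r [rs snf]]]; exists (x :: ls), l, r, rs; apply: sim_mulr. Qed.

Lemma has_nf_lmuls ls t : has_nf t -> has_nf (lmuls ls t).
Proof. by move=> nft; elim: ls => //= x ls; apply: has_nf_mull. Qed.

Lemma has_nf_rmuls rs t : has_nf t -> has_nf (rmuls t rs).
Proof. by elim: rs t => //= y rs IHrs t nft; apply/IHrs/has_nf_mulr. Qed.

(** Unfold the normal form of v: its left factors come out by [sim_left], its right
factors by [sim_assoc], and what remains is u (l r), similar to l (u r). *)
Lemma has_nf_mul u v : has_nf u -> has_nf v -> has_nf (Mul u v).
Proof.
move=> nfu [ls [l [r [rs snf]]]]; apply: has_nf_sim (sim_mulr _ snf) _.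
apply: has_nf_sim (mul_lmuls _ _ _) _; apply: has_nf_lmuls.
apply: has_nf_sim (mul_rmuls _ _ _ _) _; apply: has_nf_rmuls.
by apply: has_nf_sim (sim_left _ _ _) _; apply/has_nf_mull/has_nf_mulr.
Qed.

Lemma nf_exists u v : has_nf (Mul u v).
Proof.
have: forall t, (if t is Mul _ _ then has_nf t else True).
  elim=> // {}u IHu {}v IHv; case: u v IHu IHv => [x|u1 u2] [y|v1 v2] nfu nfv.
  - by exists [::], x, y, [::]; apply: sim_refl.
  - exact: has_nf_mull.
  - exact: has_nf_mulr.
  - exact: has_nf_mul.
by move/(_ (Mul u v)).
Qed.

Lemma perm_rmuls t rs rs' : perm_eq rs rs' -> sim (rmuls t rs) (rmuls t rs').
Proof.
have bubble s1 y s2 u : sim (rmuls u (s1 ++ y :: s2)) (rmuls (Mul u (Gen y)) (s1 ++ s2)).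
  elim: s1 u => [|a s1 IHs] u /=; first exact: sim_refl.
  by apply: sim_trans (IHs _) _; apply/sim_rmuls/sim_right.
elim: rs rs' t => [|y rs IHrs] rs' t.
  by rewrite perm_sym => /perm_nilP->; apply: sim_refl.
move=> perm_rs; have yin : y \in rs' by rewrite -(perm_mem perm_rs) mem_head.
case/splitPr: yin perm_rs => s1 s2 perm_rs.
apply: sim_sym; apply: sim_trans (bubble _ _ _ _) _; apply/sim_sym/IHrs.
by rewrite -(perm_cons y) (perm_trans perm_rs) // -[y :: s2]cat1s perm_catCA.
Qed.

Lemma perm_lmuls t ls ls' : perm_eq ls ls' -> sim (lmuls ls t) (lmuls ls' t).
Proof.
have bubble s1 x s2 : sim (lmuls (s1 ++ x :: s2) t) (Mul (Gen x) (lmuls (s1 ++ s2) t)).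
  elim: s1 => [|a s1 IHs] /=; first exact: sim_refl.
  by apply: sim_trans (sim_mulr _ IHs) _; apply: sim_left.
elim: ls ls' => [|x ls IHls] ls'.
  by rewrite perm_sym => /perm_nilP->; apply: sim_refl.
move=> perm_ls; have xin : x \in ls' by rewrite -(perm_mem perm_ls) mem_head.
case/splitPr: xin perm_ls => s1 s2 perm_ls.
apply: sim_sym; apply: sim_trans (bubble _ _ _) _; apply/sim_mulr/sim_sym/IHls.
by rewrite -(perm_cons x) (perm_trans perm_ls) // -[x :: s2]cat1s perm_catCA.
Qed.

(** The innermost left factor is not special: it can be exchanged with the next one. *)
Lemma nf_swap x l r rs :
  sim (Mul (Gen x) (rmuls (Mul (Gen l) (Gen r)) rs)) (Mul (Gen l) (rmuls (Mul (Gen x) (Gen r)) rs)).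
Proof.
apply: sim_trans (mul_rmuls _ _ _ _) _; apply: sim_sym.
by apply: sim_trans (mul_rmuls _ _ _ _) _; apply/sim_rmuls/sim_left.
Qed.

Lemma nf_perm ls l r rs ls' l' r' rs' :
  perm_eq (l :: ls) (l' :: ls') -> perm_eq (r :: rs) (r' :: rs') ->
  sim (nf ls l r rs) (nf ls' l' r' rs').
Proof.
move=> perm_l perm_r; apply: (@sim_trans (nf ls l r' rs')).
  exact/sim_lmuls/(perm_rmuls (Gen l) perm_r).
have [eql|nel] := eqVneq l l'.
  by rewrite /nf -eql; apply: perm_lmuls; rewrite -(perm_cons l) {2}eql.
have l'in : l' \in ls.
  by have := perm_mem perm_l l'; rewrite !inE eqxx eq_sym (negbTE nel).
case/splitPr: l'in perm_l => s1 s2 perm_l; rewrite /nf.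
have lcat s t : lmuls (rcons (s1 ++ s2) s) t = lmuls (s1 ++ s2) (Mul (Gen s) t).
  by rewrite /lmuls foldr_rcons.
apply: (@sim_trans (lmuls (rcons (s1 ++ s2) l') (rmuls (Mul (Gen l) (Gen r')) rs'))).
  by apply: perm_lmuls; rewrite -[l' :: s2]cat1s perm_catCA perm_sym perm_rcons.
rewrite lcat; apply: sim_trans (sim_lmuls _ (nf_swap _ _ _ _)) _; rewrite -lcat.
apply: perm_lmuls; rewrite perm_rcons -(perm_cons l') -(permPr perm_l).
rewrite -[l' :: l :: _]/([:: l'] ++ [:: l] ++ (s1 ++ s2)) perm_catCA /= perm_cons.
by rewrite perm_sym -[l' :: s2]cat1s perm_catCA.
Qed.

Lemma word_nf b ls l r rs :
  word b (nf ls l r rs) = [seq (x, true) | x <- rcons ls l] ++ [seq (y, false) | y <- r :: rs].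
Proof.
rewrite /nf; elim: ls b => [|x ls IHls] b /=; last first.
  by case: (nf_mul ls l r rs) (IHls false) => a' [b' eqn] <-; rewrite -/(nf ls l r rs) eqn.
elim/last_ind: rs => [|rs y IHrs] //=; rewrite rmuls_rcons /=.
case: (rmuls_mul (Gen l) (Gen r) rs) IHrs => a' [b' ->] /= ->.
by rewrite map_rcons -cats1.
Qed.

Lemma size_word_mul b u v : (1 < size (word b (Mul u v)))%N.
Proof.
have size0 c t : (0 < size (word c t))%N.
  by elim: t c => //= a IHa d _ c; rewrite size_cat (leq_trans (IHa true)) ?leq_addr.
by rewrite /= size_cat; have := size0 true u; have := size0 false v; lia.
Qed.

(** Both monomials have normal forms, whose left and right factors agree up to order. *)
Lemma sim_of_perm b t t' : perm_eq (word b t) (word b t') -> sim t t'.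
Proof.
case: t t' => [x|u v] [x'|u' v'] perm_w.
- by move/perm_mem/(_ (x, b)): perm_w; rewrite !inE eqxx => /esym/eqP[->]; apply: sim_refl.
- by have := size_word_mul b u' v'; rewrite -(perm_size perm_w).
- by have := size_word_mul b u v; rewrite (perm_size perm_w).
have [ls [l [r [rs snf]]]] := nf_exists u v.
have [ls' [l' [r' [rs' snf']]]] := nf_exists u' v'.
apply: (sim_trans snf); apply: (fun n => sim_trans n (sim_sym snf')).
have {perm_w} : perm_eq (word b (nf ls l r rs)) (word b (nf ls' l' r' rs')).
  by rewrite -(permPl (snf.1 b)) -(permPr (snf'.1 b)).
rewrite !word_nf => perm_w.
have filt (c : bool) (s1 s2 : seq gen) :
    [seq a.1 | a <- [seq (x, true) | x <- s1] ++ [seq (y, false) | y <- s2] & a.2 == c]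
    = if c then s1 else s2.
  rewrite filter_cat map_cat !filter_map -!map_comp /=.
  by case: c; rewrite /preim /= ?filter_pred0 ?filter_predT ?map_id ?cats0.
apply: nf_perm.
  rewrite -(perm_rcons l ls) perm_sym -(perm_rcons l' ls') perm_sym.
  by rewrite -(filt true (rcons ls l) (r :: rs)) -(filt true (rcons ls' l') (r' :: rs')) perm_map ?perm_filter.
by rewrite -(filt false (rcons ls l) (r :: rs)) -(filt false (rcons ls' l') (r' :: rs')) perm_map ?perm_filter.
Qed.
End Similarity.

(** * Colourings of the generators *)

Section PermNat.
Variable q : nat.
Implicit Types s t : 'S_q.

Lemma perm_nat_val s (i : 'I_q) : perm_nat s i = s i.
Proof. by rewrite /perm_nat valK. Qed.

Lemma perm_nat_out s i : (q <= i)%N -> perm_nat s i = i.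
Proof. by move=> le; rewrite /perm_nat insubF //= ltnNge le. Qed.

Lemma perm_natK s : cancel (perm_nat s) (perm_nat s^-1%g).
Proof.
move=> i; have [lt|le] := ltnP i q; last by rewrite !perm_nat_out.
by rewrite -[i]/(val (Ordinal lt)) !perm_nat_val permK.
Qed.
End PermNat.

Section SeqSign.
Variables (K : fieldType) (q : nat).
Implicit Types (s t : 'S_q) (z : seq nat).

Definition perm_seq s : seq nat := [seq val (s i) | i <- enum 'I_q].

(** The sign of the permutation that z lists, and 0 if z lists no permutation; written as
a sum so that swapping two entries or relabelling them is a change of variable. *)
Definition seq_sign z : K := \sum_(s : 'S_q | z == perm_seq s) (-1) ^+ s.

Lemma perm_seqP z s : reflect (size z = q /\ forall i : 'I_q, nth 0%N z i = s i) (z == perm_seq s).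
Proof.
have sz : size (perm_seq s) = q by rewrite size_map size_enum_ord.
have nths (i : 'I_q) : nth 0%N (perm_seq s) i = s i.
  by rewrite (nth_map i) ?size_enum_ord // nth_ord_enum.
apply: (iffP eqP) => [->|[szz nthz]]; first by [].
apply: (@eq_from_nth _ 0%N); rewrite ?sz // szz => i lti.
by rewrite (nthz (Ordinal lti)) (nths (Ordinal lti)).
Qed.

Lemma perm_seq_inj : injective perm_seq.
Proof.
move=> s t /eqP/perm_seqP[_ eqst]; apply/permP=> i; apply/val_inj.
by have /perm_seqP[_ eqss] := eqxx (perm_seq s); rewrite /= -eqss eqst.
Qed.

Lemma seq_sign_swap z1 i j z2 :
  seq_sign (z1 ++ i :: j :: z2) = - seq_sign (z1 ++ j :: i :: z2).
Proof.
set z := z1 ++ _; set z' := z1 ++ _.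
have szz' : size z' = size z by rewrite !size_cat.
have [szz|nsz] := eqVneq (size z) q; last first.
  rewrite /seq_sign !big1 ?oppr0 // => s /perm_seqP[]; rewrite ?szz' => sz;
  by rewrite sz eqxx in nsz.
have szE : size z = (size z1 + (size z2).+2)%N by rewrite size_cat.
have lt1 : (size z1 < q)%N by rewrite -szz szE; lia.
have lt2 : ((size z1).+1 < q)%N by rewrite -szz szE; lia.
pose a := Ordinal lt1; pose b := Ordinal lt2; pose tau := tperm a b.
have neab : a != b by rewrite -val_eqE /=; lia.
have nth_tau (k : 'I_q) : nth 0%N z' k = nth 0%N z (tau k).
  rewrite /tau; case: tpermP => [->|->|/eqP na /eqP nb]; rewrite /z /z' !nth_cat /=.
  - by rewrite ltnn subnn ltnNge leqnSn /= subSnn.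
  - by rewrite ltnn subnn ltnNge leqnSn /= subSnn.
  case: ltnP => // lek; rewrite -!val_eqE /= in na nb.
  by have -> : (k - size z1 = (k - size z1 - 2).+2)%N by lia.
rewrite /seq_sign (reindex_inj (mulgI tau)) /= -sumrN; apply: eq_big => [s|s _].
  apply/perm_seqP/perm_seqP=> -[sz H]; split; rewrite ?szz' // -?szz' // => k.
    by rewrite nth_tau H permM /tau tpermK.
  by rewrite -[k](tpermK a b) -/tau -nth_tau H permM tpermK.
by rewrite odd_permM odd_tperm neab /= signrN.
Qed.

Lemma seq_sign_perm_nat t z : seq_sign (map (perm_nat t) z) = (-1) ^+ t * seq_sign z.
Proof.
rewrite /seq_sign (reindex_inj (mulIg t)) /= mulr_sumr; apply: eq_big => [s|s _].
  rewrite (_ : perm_seq (s * t)%g = map (perm_nat t) (perm_seq s)).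
    exact/inj_eq/inj_map/can_inj/perm_natK.
  by rewrite -map_comp; apply: eq_map => i; rewrite /= perm_nat_val permM.
by rewrite odd_permM signr_addb mulrC.
Qed.

Lemma seq_sign_sqr z : perm_eq z (iota 0 q) -> seq_sign z * seq_sign z = 1.
Proof.
rewrite -val_enum_ord => perm_z.
have /tuple_permP[s defz] : perm_eq z [tuple of map val (ord_tuple q)] by [].
have eqz : z == perm_seq s.
  apply/eqP; rewrite defz /perm_seq; apply: eq_map => i.
  by rewrite tnth_map tnth_ord_tuple.
suff -> : seq_sign z = (-1) ^+ s by rewrite -expr2 sqrr_sign.
rewrite /seq_sign (big_pred1 s) // => t.
by rewrite (eqP eqz) (inj_eq perm_seq_inj) eq_sym.
Qed.
End SeqSign.

Definition odd_index (x : gen) : option nat := if x is inr j then Some j else None.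
Definition odd_indices (w : seq letter) : seq nat := pmap odd_index (map fst w).

Section Colourings.
Variables (K : fieldType) (p q : nat).
Notation colouring := ({set 'I_p} * {set 'I_q})%type.
Implicit Types (c : colouring) (w : seq letter) (g : 'S_p * 'S_q).

(** The word of the colouring c = (A, B), in which the generators of A and B are left
factors. *)
Definition target c : seq letter :=
  [seq (inl (val i), i \in c.1) | i <- enum 'I_p] ++ [seq (inr (val j), j \in c.2) | j <- enum 'I_q].

Lemma map_fst_target c : map fst (target c) = gens p q.
Proof.
by rewrite map_cat -!map_comp /gens -!val_enum_ord -!map_comp.
Qed.

Lemma mem_target_inl c (i : 'I_p) b : ((inl (val i), b) \in target c) = (b == (i \in c.1)).
Proof.
rewrite mem_cat orbC; case: mapP => [[j _ //]|_] /=.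
apply/mapP/eqP => [[j _ [/val_inj-> ->]] //|->].
by exists i; rewrite ?mem_enum.
Qed.

Lemma mem_target_inr c (j : 'I_q) b : ((inr (val j), b) \in target c) = (b == (j \in c.2)).
Proof.
rewrite mem_cat; case: mapP => [[i _ //]|_] /=.
apply/mapP/eqP => [[i _ [/val_inj-> ->]] //|->].
by exists j; rewrite ?mem_enum.
Qed.

Lemma target_inj c c' : perm_eq (target c) (target c') -> c = c'.
Proof.
case: c c' => [A B] [A' B'] /perm_mem eqt; congr (_, _).
  by apply/setP=> i; have := eqt (inl (val i), i \in A); rewrite !mem_target_inl eqxx => /esym/eqP.
by apply/setP=> i; have := eqt (inr (val i), i \in B); rewrite !mem_target_inr eqxx => /esym/eqP.
Qed.

Lemma uniq_gens : uniq (gens p q).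
Proof.
rewrite cat_uniq !map_inj_uniq ?iota_uniq /= ?andbT //; try by move=> ? ? [].
by apply/hasPn=> x /mapP[j _ ->]; apply/mapP=> -[].
Qed.

Lemma odd_indices_target c : odd_indices (target c) = iota 0 q.
Proof.
rewrite /odd_indices map_fst_target pmap_cat.
have -> (s : seq nat) : pmap odd_index (map inl s) = [::] by elim: s.
by elim: (iota 0 q) => //= j s ->.
Qed.

(** The points coloured by true are the generators that occur with the tag true; no
generator occurs with both tags, since it occurs only once. *)
Lemma colouring_of w : perm_eq (map fst w) (gens p q) -> exists c, perm_eq w (target c).
Proof.
move=> perm_w; exists ([set i : 'I_p | (inl (val i), true) \in w],
  [set j : 'I_q | (inr (val j), true) \in w]).
set c := (_, _).
have uniq_w1 : uniq (map fst w) by rewrite (perm_uniq perm_w) uniq_gens.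
have uniq_w : uniq w := map_uniq uniq_w1.
have excl x : (x, true) \in w -> (x, false) \in w -> false.
  move=> /perm_to_rem/(perm_map fst) perm1 win.
  have : (x, false) \in rem (x, true) w by rewrite mem_rem_uniq // inE win andbT; apply/eqP=> -[].
  move=> /(map_f fst) /=; have := uniq_w1; rewrite (perm_uniq perm1) /= => /andP[/negP nx _].
  by move=> /nx.
have sub : {subset w <= target c}.
  move=> [x b] wxb; have : x \in gens p q.
    by rewrite -(perm_mem perm_w); apply/mapP; exists (x, b).
  rewrite mem_cat => /orP[] /mapP[i]; rewrite mem_iota /= add0n => lti eqx; subst x.
    rewrite -[i]/(val (Ordinal lti)) mem_target_inl /c /= inE /=.
    by case: b wxb => // wf; rewrite eq_sym eqbF_neg; apply/negP=> wt; have := excl _ wt wf.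
  rewrite -[i]/(val (Ordinal lti)) mem_target_inr /c /= inE /=.
  by case: b wxb => // wf; rewrite eq_sym eqbF_neg; apply/negP=> wt; have := excl _ wt wf.
have szt : (size (target c) <= size w)%N.
  by rewrite -(size_map fst w) -(size_map fst (target c)) map_fst_target (perm_size perm_w).
have [_ eqm] := uniq_min_size uniq_w sub szt.
by apply: uniq_perm => //; apply: (@map_uniq _ _ fst); rewrite map_fst_target uniq_gens.
Qed.

Definition act_colouring g c : colouring := (g.1 @: c.1, g.2 @: c.2).

Definition act_letter g (a : letter) : letter :=
  (map_gen (perm_nat g.1) (perm_nat g.2) a.1, a.2).

Lemma word_map_monomial g b t :
  word b (map_monomial (perm_nat g.1) (perm_nat g.2) t) = map (act_letter g) (word b t).
Proof. by elim: t b => //= u IHu v IHv b; rewrite map_cat IHu IHv. Qed.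

Lemma perm_map_enum n (s : 'S_n) (T : eqType) (h k : 'I_n -> T) :
  (forall i, k i = h (s i)) -> perm_eq (map k (enum 'I_n)) (map h (enum 'I_n)).
Proof.
move=> kE; rewrite (eq_map kE) (map_comp h s); apply: perm_map.
apply: uniq_perm => [||i]; first by rewrite (map_inj_uniq (@perm_inj _ s)) enum_uniq.
  exact: enum_uniq.
rewrite [RHS]mem_enum [RHS]inE; apply/mapP.
by exists ((s^-1)%g i); rewrite ?mem_enum ?permKV.
Qed.

Lemma target_act g c : perm_eq (map (act_letter g) (target c)) (target (act_colouring g c)).
Proof.
rewrite /target map_cat; apply: perm_cat; rewrite -map_comp.
  apply: (@perm_map_enum _ g.1) => i.
  by rewrite /= /act_letter /= perm_nat_val mem_imset_perm.
apply: (@perm_map_enum _ g.2) => i.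
by rewrite /= /act_letter /= perm_nat_val mem_imset_perm.
Qed.

Lemma odd_indices_act g w : odd_indices (map (act_letter g) w) = map (perm_nat g.2) (odd_indices w).
Proof.
by elim: w => //= -[[i|j] b] w; rewrite /odd_indices /= => ->.
Qed.
End Colourings.

(** * A basis of the multilinear component *)

Lemma toF_is_linear (K : fieldType) : linear (@toF K).
Proof. by move=> c f g; rewrite toFD toFZ. Qed.

HB.instance Definition _ (K : fieldType) :=
  GRing.isLinear.Build K {malg K[monomial]} (FB K) _ (@toF K) (@toF_is_linear K).

Section Basis.
Variables (K : fieldType) (p q : nat).
Hypothesis pq_gt0 : (0 < p + q)%N.
Notation colouring := ({set 'I_p} * {set 'I_q})%type.
Notation A := {malg K[monomial]}.
Notation mon t := (toF (<< t >> : A)).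
Implicit Types (c : colouring) (w : seq letter) (g : 'S_p * 'S_q).

(** The coefficient of a word on the colouring c. *)
Definition omega c w : K :=
  if perm_eq w (target c) then seq_sign K q (odd_indices w) else 0.

Lemma odd_indices_cat w1 w2 : odd_indices (w1 ++ w2) = odd_indices w1 ++ odd_indices w2.
Proof. by rewrite /odd_indices map_cat pmap_cat. Qed.

Lemma omega_swap c w1 a b w2 : omega c (w1 ++ a :: b :: w2) =
  (-1) ^+ (odd_letter a && odd_letter b) * omega c (w1 ++ b :: a :: w2).
Proof.
rewrite /omega.
have -> : perm_eq (w1 ++ a :: b :: w2) (target c) = perm_eq (w1 ++ b :: a :: w2) (target c).
  by apply: permPl; rewrite perm_cat2l -[a :: b :: w2]/([:: a] ++ [:: b] ++ w2) perm_catCA.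
case: ifP => _; last by rewrite mulr0.
rewrite !odd_indices_cat; case: a b => [[i|i] b] [[j|j] b'] /=;
  rewrite /odd_letter /= ?mul1r ?expr1 //.
by rewrite mulN1r -seq_sign_swap.
Qed.

Definition colour_coef c : A -> K^o := linext (fun t => omega c (word false t) : K^o).
HB.instance Definition _ c := GRing.Linear.on (colour_coef c).

Lemma colour_coef_ideal c f : bicomm_ideal f -> colour_coef c f = 0.
Proof.
move=> If; rewrite -[RHS](omega_ideal (@omega_swap c) false [::] [::] If).
by apply: eq_linext => t; rewrite /= cats0.
Qed.

Definition mon_sign t : K := seq_sign K q (odd_indices (word false t)).

Lemma mon_sign_sqr t c : perm_eq (word false t) (target c) -> mon_sign t * mon_sign t = 1.
Proof.
move=> perm_t; apply: seq_sign_sqr; rewrite -(odd_indices_target c).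
exact/perm_pmap/perm_map.
Qed.

(** A single generator is read with the tag false, so in degree 1 one colouring is
realised. *)
Definition realised : {set colouring} :=
  [set c | `[< exists t, perm_eq (word false t) (target c) >]].

(** The value outside the realised colourings is arbitrary. *)
Definition mon_of c : monomial :=
  if pselect (exists t, perm_eq (word false t) (target c)) is left ex then projT1 (cid ex)
  else Gen (inl 0%N).

Lemma mon_ofP c : c \in realised -> perm_eq (word false (mon_of c)) (target c).
Proof.
by rewrite inE => /asboolP ex; rewrite /mon_of; case: pselect => // ex'; case: cid.
Qed.

Lemma realisedP t c : perm_eq (word false t) (target c) -> c \in realised.
Proof. by move=> perm_t; rewrite inE; apply/asboolP; exists t. Qed.

Definition basis c : FB K := mon_sign (mon_of c) *: mon (mon_of c).

Lemma colour_coefU c t : colour_coef c << t >> = omega c (word false t).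
Proof. exact: linextU. Qed.

(** The monomial is similar to the chosen one with the same colouring, and applying the
coefficient of this colouring identifies the sign. *)
Lemma mon_basis t c : perm_eq (word false t) (target c) -> mon t = mon_sign t *: basis c.
Proof.
move=> perm_t; have perm_c := mon_ofP (realisedP perm_t).
have [_ [s eqt]] : sim K t (mon_of c).
  by apply: (@sim_of_perm _ false); rewrite (permPl perm_t) perm_sym.
have : bicomm_ideal (<< t >> - (-1) ^+ s *: << mon_of c >> : A).
  by apply/toFP; rewrite toFZ.
move/(colour_coef_ideal c); rewrite linearB linearZ /= !colour_coefU.
rewrite /omega perm_t perm_c -!/(mon_sign _) => /eqP; rewrite subr_eq0 => /eqP ->.
by rewrite /basis !scalerA /GRing.scale /= -mulrA (mon_sign_sqr perm_c) mulr1.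
Qed.

Lemma basis_free (a : colouring -> K) :
  \sum_(c in realised) a c *: basis c = 0 -> {in realised, forall c, a c = 0}.
Proof.
move=> sum0 c Ic.
pose f : A := \sum_(c in realised) (a c * mon_sign (mon_of c)) *: << mon_of c >>.
have : toF f = toF 0.
  rewrite linear0 -[RHS]sum0 linear_sum; apply: eq_bigr => c' _.
  by rewrite linearZ scalerA.
move/toFP; rewrite subr0 => /(colour_coef_ideal c).
rewrite linear_sum (bigD1 c) //= big1 ?addr0; last first.
  move=> c' /andP[Ic' nc]; rewrite linearZ /= colour_coefU /omega.
  case: ifP => [perm_c'|_]; last exact: scaler0.
  case/eqP: nc; apply: (@target_inj p q); apply: perm_trans perm_c'.
  by rewrite perm_sym mon_ofP.
rewrite linearZ /= colour_coefU /omega mon_ofP // -/(mon_sign _) /GRing.scale /=.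
by rewrite -mulrA (mon_sign_sqr (mon_ofP Ic)) mulr1.
Qed.

Lemma basis_span x : @multilinear K p q x <->
  exists a : colouring -> K, x = \sum_(c in realised) a c *: basis c.
Proof.
split=> [[f fP ->]|[a ->]].
  have {fP} fP u : u \in msupp f -> exists c, perm_eq (word false u) (target c).
    by move=> /fP perm_u; apply: colouring_of; rewrite map_fst_word.
  exists (fun c => \sum_(u <- msupp f | perm_eq (word false u) (target c)) f@_u * mon_sign u).
  rewrite [in LHS](monalgE f) linear_sum.
  under [RHS]eq_bigr do rewrite scaler_suml.
  rewrite (exchange_big_dep xpredT) //=; apply: eq_big_seq => u uf.
  have [c perm_u] := fP u uf; rewrite (big_pred1 c) => [|c'].
    have -> : << f@_u *g u >> = f@_u *: << u >> :> A.
      by apply/malgP=> k; rewrite mcoeffZ !mcoeffU mulr_natr.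
    by rewrite linearZ /= (mon_basis perm_u) scalerA.
  apply/andP/eqP=> [[_ perm_u']|->]; last by rewrite (realisedP perm_u).
  by apply: (@target_inj p q); apply: perm_trans perm_u; rewrite perm_sym.
exists (\sum_(c in realised) (a c * mon_sign (mon_of c)) *: << mon_of c >>).
  move=> u; apply: contraTT => nperm; rewrite -mcoeff_eq0 raddf_sum big1 // => c Ic.
  rewrite /= mcoeffZ mcoeffU; case: eqP => [eq_u|_]; last by rewrite mulr0n mulr0.
  case/negP: nperm; rewrite -eq_u -(map_fst_word false) -(map_fst_target c).
  by apply: perm_map; apply: mon_ofP.
by rewrite linear_sum; apply: eq_bigr => c _; rewrite [RHS]linearZ /= /basis scalerA.
Qed.

Lemma realised_act g c : c \in realised -> act_colouring g c \in realised.
Proof.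
move=> /mon_ofP perm_c; apply: (@realisedP (map_monomial (perm_nat g.1) (perm_nat g.2) (mon_of c))).
by rewrite word_map_monomial; apply: perm_trans (target_act g c); apply: perm_map.
Qed.

(** The sign of t factors out of the listing of the odd letters, whatever their tags. *)
Lemma act_basis g c : c \in realised ->
  FB_act g (basis c) = (-1) ^+ g.2 *: basis (act_colouring g c).
Proof.
move=> Ic; have perm_c := mon_ofP Ic.
have perm_gc : perm_eq (word false (map_monomial (perm_nat g.1) (perm_nat g.2) (mon_of c)))
    (target (act_colouring g c)).
  by rewrite word_map_monomial; apply: perm_trans (target_act g c); apply: perm_map.
rewrite /basis -[in LHS]linearZ /= /FB_act Fmap_toF linearZ /= amap.unlock linextU.
rewrite linearZ /= (mon_basis perm_gc) scalerA; congr (_ *: _).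
rewrite {2}/mon_sign word_map_monomial odd_indices_act seq_sign_perm_nat -/(mon_sign _).
by rewrite mulrCA (mon_sign_sqr perm_c) mulr1.
Qed.

Lemma has_target_true c : has (fun a : letter => a.2) (target c) = (c != (set0, set0)).
Proof.
case: c => A B; apply/hasP/idP=> [[[x b] + /= bT]|].
  rewrite bT; apply: contraTneq => ->.
  by rewrite mem_cat; apply/norP; split; apply/mapP=> -[i _ [_]]; rewrite inE.
rewrite xpair_eqE negb_and => /orP[] /set0Pn[i ci].
  by exists (inl (val i), true) => //; rewrite mem_target_inl /= ci.
by exists (inr (val i), true) => //; rewrite mem_target_inr /= ci.
Qed.

Lemma has_target_false c : has (fun a : letter => ~~ a.2) (target c) = (c != (setT, setT)).
Proof.
case: c => A B; apply/hasP/idP=> [[[x b] + /= /negbTE bF]|].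
  rewrite bF; apply: contraTneq => ->.
  by rewrite mem_cat; apply/norP; split; apply/mapP=> -[i _ [_]]; rewrite inE.
rewrite xpair_eqE negb_and -(inj_eq (@setC_inj _) A) -(inj_eq (@setC_inj _) B) !setCT => /orP[] /set0Pn[i].
  by rewrite inE => ci; exists (inl (val i), false) => //; rewrite mem_target_inl /= (negbTE ci).
by rewrite inE => ci; exists (inr (val i), false) => //; rewrite mem_target_inr /= (negbTE ci).
Qed.

(** A product contains a left and a right factor; conversely a normal form can be written
as soon as both kinds are present. *)
Lemma realisedE c : (c \in realised) =
  has (fun a : letter => ~~ a.2) (target c) && ((p + q == 1)%N || has (fun a : letter => a.2) (target c)).
Proof.
have sz_target : size (target c) = (p + q)%N.
  by rewrite -(size_map fst) map_fst_target size_cat !size_map !size_iota.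
apply/idP/andP=> [/mon_ofP|[/hasP[[y by'] yc /= /negbTE y_false]]].
  case: (mon_of c) => [x|u v] perm_t.
    have has_t := eq_has_r (perm_mem perm_t); rewrite -!has_t /=; split=> //.
    by have := perm_size perm_t; rewrite sz_target /= => <-.
  have := nf_exists K u v; case=> ls [l [r [rs [perm_nf _]]]].
  have {}perm_t : perm_eq (word false (nf ls l r rs)) (target c).
    by rewrite -(permPl (perm_nf false)).
  have has_t := eq_has_r (perm_mem perm_t); rewrite -!has_t word_nf !has_cat !has_map.
  by rewrite /= !has_rcons /= !orbT.
rewrite {by'}y_false in yc * => /orP[/eqP pq1|/hasP[[x bx] xc /= x_true]].
  apply: (@realisedP (Gen y)); apply: uniq_perm => //.
    by apply: (@map_uniq _ _ fst); rewrite map_fst_target uniq_gens.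
  have sub : {subset [:: (y, false)] <= target c} by move=> a; rewrite inE => /eqP->.
  by have [] := uniq_min_size (isT : uniq [:: (y, false)]) sub; rewrite ?sz_target ?pq1.
have perm_L : perm_eq ([seq a <- target c | a.2] ++ [seq a <- target c | ~~ a.2]) (target c).
  exact/permEl/perm_filterC.
have untag b (s : seq letter) : all (fun a => a.2 == b) s -> s = [seq (x', b) | x' <- map fst s].
  by elim: s => //= -[z b'] s IHs /= /andP[/eqP-> /IHs <-].
have := untag true [seq a <- target c | a.2].
have -> : all (fun a : letter => a.2 == true) [seq a <- target c | a.2].
  by apply/allP=> a; rewrite mem_filter => /andP[->].
have := untag false [seq a <- target c | ~~ a.2].
have -> : all (fun a : letter => a.2 == false) [seq a <- target c | ~~ a.2].
  by apply/allP=> a; rewrite mem_filter => /andP[/negbTE->].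
move=> /(_ isT) defR /(_ isT) defL.
have : (x, bx) \in [seq a <- target c | a.2] by rewrite mem_filter xc andbT.
have : (y, false) \in [seq a <- target c | ~~ a.2] by rewrite mem_filter yc.
move: [seq a <- target c | a.2] [seq a <- target c | ~~ a.2] defL defR perm_L.
case=> [|l L]; first by move=> ? _ _ _ _; rewrite in_nil.
case=> [|r R]; first by move=> _ _ _; rewrite in_nil.
move=> defL defR perm_L _ _.
apply: (@realisedP (nf (map fst L) l.1 r.1 (map fst R))); rewrite word_nf.
apply: perm_trans perm_L; rewrite defL defR; apply: perm_cat => //.
by rewrite map_rcons perm_rcons.
Qed.

Definition n_unrealised : nat := if (p + q == 1)%N then 1 else 2.

(** The colourings that are not realised are constant, hence fixed by all permutations. *)
Lemma card_fixed_realised g :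
  (#|[set c in realised | act_colouring g c == c]| + n_unrealised
   = fixed_subsets g.1 * fixed_subsets g.2)%N.
Proof.
have actT n (s : 'S_n) : s @: setT = setT.
  by apply/setP=> i; rewrite -[i](permKV s) mem_imset_perm !inE.
have -> : (fixed_subsets g.1 * fixed_subsets g.2)%N = #|[set c : colouring | act_colouring g c == c]|.
  rewrite -cardsX; apply: eq_card => -[A B]; rewrite !inE.
  by rewrite /act_colouring xpair_eqE.
rewrite -[RHS](cardsID realised); congr (_ + _)%N.
  by apply: eq_card => c; rewrite !inE andbC.
have fixT : act_colouring g (setT, setT) == (setT, setT) by rewrite /act_colouring /= !actT.
have fix0 : act_colouring g (set0, set0) == (set0, set0) by rewrite /act_colouring /= !imset0.
have ne0T : (set0, set0) != (setT, setT) :> colouring.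
  apply: contraTneq pq_gt0 => -[eqp eqq]; rewrite -leqNgt -[p]card_ord -[q]card_ord.
  by rewrite -!cardsT -eqp -eqq !cards0.
rewrite /n_unrealised.
have setDE c : (c \in [set c : colouring | act_colouring g c == c] :\: realised) =
   (c == (setT, setT)) || (p + q != 1)%N && (c == (set0, set0)).
  rewrite inE realisedE has_target_true has_target_false negb_and negb_or !negbK.
  rewrite [c \in [set _ | _]]inE andb_idr // => /orP[/eqP->//|/andP[_ /eqP->//]].
case: eqP => pq1; apply/esym.
  rewrite (_ : _ :\: _ = [set (setT, setT)]) ?cards1 //.
  by apply/setP=> c; rewrite setDE pq1 /= orbF inE.
rewrite (_ : _ :\: _ = [set (setT, setT); (set0, set0)]) ?cards2 1?eq_sym ?ne0T //.
by apply/setP=> c; rewrite setDE !inE (introN eqP pq1).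
Qed.
End Basis.

(** * The cocharacter *)

Theorem theorem6p4 (K : fieldType) (charK : [pchar K] =i pred0)
    (p q : nat) (pq_gt0 : (0 < p + q)%N) :
  has_character (@multilinear K p q) (@FB_act K p q)
    (fun g : 'S_p * 'S_q =>
       \sum_(la : intpart p) \sum_(mu : intpart q)
          (multiplicity (parts la) (parts mu))%:R
            * (specht_char K la g.1 * specht_char K mu g.2)).
Proof.
pose I := @realised p q.
exists #|I|, (fun i => basis K (enum_val i)); split=> [x|a|g].
- rewrite basis_span; split=> [[a ->]|[a ->]].
    by exists (fun i => a (enum_val i)); rewrite big_enum_val.
  (* Coefficients on I extend to all colourings; an index is needed to do so. *)
  case: (pickP 'I_#|I|) => [i0 _|none].
    exists (fun c => a (enum_rank_in (enum_valP i0) c)); rewrite [RHS]big_enum_val.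
    by apply: eq_bigr => i _; rewrite enum_valK_in.
  exists (fun=> 0); rewrite !big1 // => [c Ic|i]; last by have := none i.
  by rewrite scale0r.
- move=> sum0 i; pose b c := a (enum_rank_in (enum_valP i) c).
  have bE j : b (enum_val j) = a j by rewrite /b enum_valK_in.
  rewrite -bE; apply: (basis_free (K:=K)); last exact: enum_valP.
  by rewrite [LHS]big_enum_val -[RHS]sum0; apply: eq_bigr => j _; rewrite bE.
exists ((-1) ^+ g.2 *: fmx I I (fun c c' => (c' == act_colouring g c)%:R)); split.
  move=> i; rewrite act_basis ?enum_valP //.
  transitivity (\sum_(c in I) (-1) ^+ g.2 * (c == act_colouring g (enum_val i))%:R *: basis K c).
    rewrite (bigD1 (act_colouring g (enum_val i))) /=; last by rewrite realised_act ?enum_valP.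
    rewrite eqxx mulr1 big1 ?addr0 // => c /andP[_ /negbTE->].
    by rewrite mulr0 scale0r.
  by rewrite [LHS]big_enum_val; apply: eq_bigr => j _; rewrite !mxE.
rewrite cocharacter_formula // mxtraceZ mxtrace_fmx; congr (_ * _).
rewrite -(card_fixed_realised K pq_gt0 g) natrD addrK -sum1_card natr_sum.
rewrite [RHS]big_mkcond [LHS]big_mkcond /=; apply: eq_bigr => c _.
by rewrite inE eq_sym; case: (c \in I); case: eqP.
Qed.
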